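(* Let $M$ be a compact manifold of real dimension $2n$ with an LCAK structure $(g,J,F,\theta)$, and let $T=\theta^\sharp$. Suppose that the image of the Nijenhuis tensor of $J$ is $g$-orthogonal to $\mathrm{Span}(T,JT)$. Then $g$ is an anti-pluricanonical LCAK metric that is Gauduchon if and only if $\theta$ is $D$-parallel, i.e. $D\theta=0$, where $D$ is the Levi-Civita connection of $g$.
   Context: An LCAK (locally conformally almost Kähler) structure $(g,J,F,\theta)$ on a manifold $M$ of real dimension $2n$ consists of an almost complex structure $J$ (not necessarily integrable), a non-degenerate $2$-form $F$ and a closed $1$-form $\theta$ (the Lee form) with $dF=\theta\wedge F$, such that $g:=F(\cdot,J\cdot)$ is a Riemannian metric. $T=\theta^\sharp$ is the $g$-dual of $\theta$. The Nijenhuis tensor is $4N(X,Y)=[JX,JY]-[X,Y]-J[JX,Y]-J[X,JY]$. The metric $g$ is Gauduchon if $\delta^g\theta=0$, with $\delta^g$ the codifferential. $D\theta$ is the $2$-tensor $(D\theta)(X,Y)=(D_X\theta)(Y)$; a $2$-tensor $\phi$ is $J$-invariant if $\phi(JX,JY)=\phi(X,Y)$ for all $X,Y$. The LCAK metric $g$ is anti-pluricanonical if the image of $N$ is $g$-orthogonal to $\mathrm{Span}(T,JT)$ and $D\theta$ is $J$-invariant. *)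

(* Defs.v *)
(* Smooth manifolds are given by atlases, tensor fields by
   their matrices of components in the charts of the atlas, and the differential
   operators by their invariant formulas on vector fields over a chart.
   Tangent vectors are row vectors, so linear maps act by right multiplication. *)
From HB Require Import structures.
From mathcomp Require Import all_boot all_order all_algebra.
From mathcomp Require Import all_classical all_reals all_analysis.

Set Implicit Arguments.
Unset Strict Implicit.
Unset Printing Implicit Defensive.

Import Order.TTheory GRing.Theory Num.Theory.
Import numFieldNormedType.Exports.

Local Open Scope classical_set_scope.
Local Open Scope ring_scope.

Section Smooth.
Context {R : realType} {V W : normedModType R}.

(* [U] is meant to be open; the values of [f] outside [U] are irrelevant. *)
Fixpoint C_on (k : nat) (U : set V) (f : V -> W) : Prop :=
  match k with
  | 0 => forall x, U x -> {for x, continuous f}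
  | k'.+1 => (forall x, U x -> differentiable f x) /\
             (forall v, C_on k' U (fun x => 'D_v f x))
  end.

Definition smooth_on (U : set V) (f : V -> W) : Prop := forall k, C_on k U f.

End Smooth.

(** * Calculus over an open subset of R^m *)

Section LocalCalculus.
Context {R : realType} {m : nat}.
Local Notation E := 'rV[R]_m.
Implicit Types (f : E -> R) (X Y Z : E -> E) (alpha : E -> 'cV[R]_m)
  (A B g J F : E -> 'M[R]_m) (D : (E -> E) -> (E -> E) -> E -> E).

Definition ev1 alpha X : E -> R := fun x => (X x *m alpha x) 0 0.

Definition ev2 B X Y : E -> R := fun x => (X x *m B x *m (Y x)^T) 0 0.

Definition app A X : E -> E := fun x => X x *m A x.

Definition coord_field (i : 'I_m) : E -> E := fun=> delta_mx 0 i.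

Definition vderiv X f : E -> R := fun x => 'D_(X x) f x.

Definition bracket X Y : E -> E := fun x => 'D_(X x) Y x - 'D_(Y x) X x.

Definition nijenhuis J X Y : E -> E := fun x =>
  4^-1 *: (bracket (app J X) (app J Y) x - bracket X Y x
           - app J (bracket (app J X) Y) x - app J (bracket X (app J Y)) x).

(* The exterior derivative and the wedge product both follow the convention
   (a /\ b)(X, Y) = a(X) b(Y) - a(Y) b(X), without numerical factors. *)
Definition ext_deriv1 alpha X Y : E -> R := fun x =>
  vderiv X (ev1 alpha Y) x - vderiv Y (ev1 alpha X) x
  - ev1 alpha (bracket X Y) x.

Definition ext_deriv2 F X Y Z : E -> R := fun x =>
  vderiv X (ev2 F Y Z) x - vderiv Y (ev2 F X Z) x + vderiv Z (ev2 F X Y) x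
  - ev2 F (bracket X Y) Z x + ev2 F (bracket X Z) Y x
  - ev2 F (bracket Y Z) X x.

Definition wedge12 alpha F X Y Z : E -> R := fun x =>
  ev1 alpha X x * ev2 F Y Z x - ev1 alpha Y x * ev2 F X Z x
  + ev1 alpha Z x * ev2 F X Y x.

(* To be used when [g x] is invertible, see [ev2_sharp]. *)
Definition sharp g alpha : E -> E := fun x => (alpha x)^T *m invmx (g x).

Lemma ev2_sharp g alpha Y x :
  g x \in unitmx -> ev2 g (sharp g alpha) Y x = ev1 alpha Y x.
Proof.
move=> gU; rewrite /ev2 /ev1 /sharp mulmxKV // -trmx_mul.
by rewrite mxE.
Qed.

Definition affine_connection (U : set E) D : Prop :=
  [/\ forall X Y, smooth_on U X -> smooth_on U Y -> smooth_on U (D X Y),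
      forall X X' Y, smooth_on U X -> smooth_on U X' -> smooth_on U Y ->
        forall x, U x -> D (fun y => X y + X' y) Y x = D X Y x + D X' Y x,
      forall f X Y, smooth_on U f -> smooth_on U X -> smooth_on U Y ->
        forall x, U x -> D (fun y => f y *: X y) Y x = f x *: D X Y x,
      forall X Y Y', smooth_on U X -> smooth_on U Y -> smooth_on U Y' ->
        forall x, U x -> D X (fun y => Y y + Y' y) x = D X Y x + D X Y' x
    & forall f X Y, smooth_on U f -> smooth_on U X -> smooth_on U Y ->
        forall x, U x ->
        D X (fun y => f y *: Y y) x = vderiv X f x *: Y x + f x *: D X Y x].

Definition torsion_free (U : set E) D : Prop :=
  forall X Y, smooth_on U X -> smooth_on U Y ->
  forall x, U x -> D X Y x - D Y X x = bracket X Y x.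

Definition metric_connection (U : set E) g D : Prop :=
  forall X Y Z, smooth_on U X -> smooth_on U Y -> smooth_on U Z ->
  forall x, U x ->
    vderiv X (ev2 g Y Z) x = ev2 g (D X Y) Z x + ev2 g Y (D X Z) x.

Definition levi_civita (U : set E) g D : Prop :=
  [/\ affine_connection U D, torsion_free U D & metric_connection U g D].

(* (D_X alpha)(Y) *)
Definition cov_deriv D alpha X Y : E -> R := fun x =>
  vderiv X (ev1 alpha Y) x - ev1 alpha (D X Y) x.

(* Minus the trace with respect to [g] of the covariant derivative, in the
   coordinate frame. *)
Definition codiff g D alpha : E -> R := fun x =>
  - \sum_(i < m) \sum_(j < m)
      invmx (g x) i j * cov_deriv D alpha (coord_field i) (coord_field j) x.

End LocalCalculus.

(** * Manifolds and tensor fields *)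

Record manifold (R : realType) (m : nat) := Manifold {
  carrier :> topologicalType;
  hausdorff_carrier : hausdorff_space carrier;
  second_countable_carrier : @second_countable carrier;
  chart : Type;
  dom : chart -> set carrier;
  cod : chart -> set 'rV[R]_m;
  coord : chart -> carrier -> 'rV[R]_m;
  param : chart -> 'rV[R]_m -> carrier;
  open_dom : forall a, open (dom a);
  open_cod : forall a, open (cod a);
  coord_cod : forall a p, dom a p -> cod a (coord a p);
  param_dom : forall a x, cod a x -> dom a (param a x);
  coordK : forall a p, dom a p -> param a (coord a p) = p;
  paramK : forall a x, cod a x -> coord a (param a x) = x;
  continuous_coord : forall a p, dom a p -> {for p, continuous (coord a)};
  continuous_param : forall a x, cod a x -> {for x, continuous (param a)};
  chart_cover : forall p, exists a, dom a p;
  smooth_trans : forall a b,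
    smooth_on (cod a `&` param a @^-1` dom b) (coord b \o param a)
}.

Section TensorFields.
Context {R : realType} {m : nat} (M : manifold R m).
Implicit Types a b : chart M.

Definition trans a b : 'rV[R]_m -> 'rV[R]_m := coord b \o param a.

Definition overlap a b : set 'rV[R]_m := cod a `&` param a @^-1` dom b.

(* The differential of [trans a b] at [x] is [v |-> v *m 'J (trans a b) x]. *)

Definition covector_field (alpha : chart M -> 'rV[R]_m -> 'cV[R]_m) : Prop :=
  (forall a, smooth_on (cod a) (alpha a)) /\
  (forall a b x, overlap a b x ->
     alpha a x = 'J (trans a b) x *m alpha b (trans a b x)).

Definition endomorphism_field (A : chart M -> 'rV[R]_m -> 'M[R]_m) : Prop :=
  (forall a, smooth_on (cod a) (A a)) /\
  (forall a b x, overlap a b x ->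
     A a x *m 'J (trans a b) x = 'J (trans a b) x *m A b (trans a b x)).

Definition bilinear_field (B : chart M -> 'rV[R]_m -> 'M[R]_m) : Prop :=
  (forall a, smooth_on (cod a) (B a)) /\
  (forall a b x, overlap a b x ->
     B a x = 'J (trans a b) x *m B b (trans a b x) *m ('J (trans a b) x)^T).

End TensorFields.

(** * LCAK structures *)

Record lcak (R : realType) (m : nat) (M : manifold R m) := LCAK {
  acs : chart M -> 'rV[R]_m -> 'M[R]_m;
  fform : chart M -> 'rV[R]_m -> 'M[R]_m;
  lee : chart M -> 'rV[R]_m -> 'cV[R]_m;
  (* g(X, Y) = F(X, J Y) *)
  metric : chart M -> 'rV[R]_m -> 'M[R]_m :=
    fun a x => fform a x *m (acs a x)^T;
  acs_field : endomorphism_field acs;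
  fform_field : bilinear_field fform;
  lee_field : covector_field lee;
  acs_sqr : forall a x, cod a x -> acs a x *m acs a x = - 1%:M;
  fform_skew : forall a x, cod a x -> (fform a x)^T = - fform a x;
  fform_nondegenerate : forall a x, cod a x -> fform a x \in unitmx;
  lee_closed : forall a X Y, smooth_on (cod a) X -> smooth_on (cod a) Y ->
    forall x, cod a x -> ext_deriv1 (lee a) X Y x = 0;
  fform_lee : forall a X Y Z, smooth_on (cod a) X -> smooth_on (cod a) Y ->
    smooth_on (cod a) Z -> forall x, cod a x ->
    ext_deriv2 (fform a) X Y Z x = wedge12 (lee a) (fform a) X Y Z x;
  metric_sym : forall a x, cod a x -> (metric a x)^T = metric a x;
  metric_posdef : forall a x (v : 'rV[R]_m), cod a x -> v != 0 ->
    0 < (v *m metric a x *m v^T) 0 0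
}.

Section LCAKNotions.
Context {R : realType} {m : nat} {M : manifold R m}.
Local Notation E := 'rV[R]_m.

(* The Levi-Civita connection acts on vector fields over each chart; as it is
   determined there by the metric, its local expressions agree on overlaps. *)
Definition levi_civita_connection (S : lcak M)
    (D : chart M -> (E -> E) -> (E -> E) -> E -> E) : Prop :=
  forall a, levi_civita (cod a) (metric S a) (D a).

Definition lee_vector (S : lcak M) (a : chart M) : E -> E :=
  sharp (metric S a) (lee S a).

Definition nijenhuis_orthogonal (S : lcak M) : Prop :=
  forall a X Y, smooth_on (cod a) X -> smooth_on (cod a) Y ->
  forall (s t : R) x, cod a x ->
    ev2 (metric S a) (nijenhuis (acs S a) X Y)
      (fun y => s *: lee_vector S a y + t *: app (acs S a) (lee_vector S a) y) x
    = 0.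

Variables (S : lcak M) (D : chart M -> (E -> E) -> (E -> E) -> E -> E).

Definition lee_deriv_J_invariant : Prop :=
  forall a X Y, smooth_on (cod a) X -> smooth_on (cod a) Y ->
  forall x, cod a x ->
    cov_deriv (D a) (lee S a) (app (acs S a) X) (app (acs S a) Y) x
    = cov_deriv (D a) (lee S a) X Y x.

Definition anti_pluricanonical : Prop :=
  nijenhuis_orthogonal S /\ lee_deriv_J_invariant.

Definition gauduchon : Prop :=
  forall a x, cod a x -> codiff (metric S a) (D a) (lee S a) x = 0.

Definition lee_parallel : Prop :=
  forall a X Y, smooth_on (cod a) X -> smooth_on (cod a) Y ->
  forall x, cod a x -> cov_deriv (D a) (lee S a) X Y x = 0.

End LCAKNotions.

(* Main.v *)
(* Write T for the Lee vector field, f = |T|^2 = theta(T) and L for the Lie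
   derivative.  As theta is closed, L_T g = 2 D theta and L_T theta = df, and
   dF = theta /\ F gives L_T F = f F + theta /\ (theta o J) - d(theta o J).
   Because theta is closed, the J-anti-invariant part of d(theta o J) is
   theta(J N), up to a constant, so the hypothesis on N makes L_T F J-invariant;
   if moreover D theta is J-invariant, then L_T J = 0.  Hence
   L_T (theta o J) = df o J and
     L_T (L_T F) = (T f) F + f L_T F + df /\ (theta o J) + theta /\ (df o J)
                   - d(df o J).
   If g is Gauduchon, L_T F has zero trace against F^-1, so the trace of the left
   hand side is |L_T g|^2.  On the right the only second derivatives of f come
   from d(df o J) and give twice the Laplacian, whence an equation
     2 g^{ij} d_i d_j f + b^k d_k f = |L_T g|^2 >= 0
   in every chart.  By Hopf's strong maximum principle f is constant on each
   connected component of the compact manifold, and then L_T g = 0. *)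
Require Import Defs.
From mathcomp Require Import all_boot all_order all_algebra.
From mathcomp Require Import all_classical all_reals all_analysis.
From mathcomp Require Import ring lra.
Import numFieldNormedType.Exports.
Import Order.TTheory GRing.Theory Num.Theory.
Local Open Scope classical_set_scope.
Local Open Scope ring_scope.

Set Implicit Arguments.
Unset Strict Implicit.
Unset Printing Implicit Defensive.

(** * Forms and matrices *)

Section Forms.
Context {R : realFieldType}.

(** The connection serves only to identify [2 D theta] with [L_T g]; no covariant derivative occurs
    afterwards. With tangent vectors as rows and [A] the Jacobian of [T], a bilinear form has
    [L_T B = D_T B + A B + B A^T], a one-form [L_T a = D_T a + A a], and an endomorphism field
    [L_T J = D_T J + A J - J A]. Constant fields, whose brackets vanish, turn the differential
    hypotheses into relations between partial derivatives at a point, so each step becomes a matrix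
    identity with the derivatives as opaque letters. Symmetry of second derivatives enters only
    where [d] has to commute with [L_T]. A maximum principle replaces integration over the manifold:
    it needs neither a volume form nor a divergence theorem, and it accepts any smooth first-order
    coefficients, so the drift may be a non-tensorial expression that changes from chart to
    chart. *)

Definition lin m (a : 'cV[R]_m) (u : 'rV[R]_m) : R := (u *m a) 0 0.
Definition bil m (B : 'M[R]_m) (u v : 'rV[R]_m) : R := (u *m B *m v^T) 0 0.

Lemma dotC m (u v : 'rV[R]_m) : (u *m v^T) 0 0 = (v *m u^T) 0 0.
Proof. by rewrite -[in LHS](trmxK u) -trmx_mul mxE. Qed.

Lemma linZ m c (a : 'cV[R]_m) u : lin (c *: a) u = c * lin a u.
Proof. by rewrite /lin -scalemxAr mxE. Qed.

Lemma linD m (a b : 'cV[R]_m) u : lin (a + b) u = lin a u + lin b u.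
Proof. by rewrite /lin mulmxDr mxE. Qed.

Lemma linN m (a : 'cV[R]_m) u : lin (- a) u = - lin a u.
Proof. by rewrite /lin mulmxN mxE. Qed.

Lemma lin_mul m (A : 'M[R]_m) a u : lin (A *m a) u = lin a (u *m A).
Proof. by rewrite /lin mulmxA. Qed.

Lemma lin_Dr m (a : 'cV[R]_m) u v : lin a (u + v) = lin a u + lin a v.
Proof. by rewrite /lin mulmxDl mxE. Qed.

Lemma lin_Nr m (a : 'cV[R]_m) u : lin a (- u) = - lin a u.
Proof. by rewrite /lin mulNmx mxE. Qed.

Lemma bilD m (A B : 'M[R]_m) u v : bil (A + B) u v = bil A u v + bil B u v.
Proof. by rewrite /bil mulmxDr mulmxDl mxE. Qed.

Lemma bilN m (A : 'M[R]_m) u v : bil (- A) u v = - bil A u v.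
Proof. by rewrite /bil mulmxN mulNmx mxE. Qed.

Lemma bilZ m c (A : 'M[R]_m) u v : bil (c *: A) u v = c * bil A u v.
Proof. by rewrite /bil -scalemxAr -scalemxAl mxE. Qed.

Lemma trmxD p q (A B : 'M[R]_(p, q)) : (A + B)^T = A^T + B^T.
Proof. exact: raddfD. Qed.

Lemma bil_Dr m (A : 'M[R]_m) u v w : bil A u (v + w) = bil A u v + bil A u w.
Proof. by rewrite /bil raddfD /= mulmxDr mxE. Qed.

Lemma bil_Nr m (A : 'M[R]_m) u v : bil A u (- v) = - bil A u v.
Proof. by rewrite /bil raddfN /= mulmxN mxE. Qed.

Lemma bilT m (A : 'M[R]_m) u v : bil A^T u v = bil A v u.
Proof.
by rewrite /bil -[in LHS](trmxK u) -!trmx_mul mxE mulmxA.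
Qed.

Lemma bil_sym m (h : 'M[R]_m) (u v : 'rV[R]_m) : h^T = h -> bil h u v = bil h v u.
Proof. by move=> hT; rewrite -bilT hT. Qed.

Lemma bil_Dl m (h : 'M[R]_m) (u v w : 'rV[R]_m) : bil h (u + v) w = bil h u w + bil h v w.
Proof. by rewrite /bil !mulmxDl mxE. Qed.

Lemma bil_Nl m (h : 'M[R]_m) (u v : 'rV[R]_m) : bil h (- u) v = - bil h u v.
Proof. by rewrite /bil !mulNmx mxE. Qed.

Lemma bil_tensor m (a b : 'cV[R]_m) u v : bil (a *m b^T) u v = lin a u * lin b v.
Proof.
rewrite /bil /lin mulmxA -mulmxA -trmx_mul mxE big_ord1 [in X in _ * X]mxE.
by congr (_ * _).
Qed.

Lemma bil_lin m (A : 'M[R]_m) u v : bil A u v = lin (u *m A)^T v.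
Proof. by rewrite /bil /lin -[v in RHS]trmxK -trmx_mul [RHS]mxE. Qed.

Lemma bil_mull m (A B : 'M[R]_m) u v : bil (A *m B) u v = bil B (u *m A) v.
Proof. by rewrite /bil mulmxA. Qed.

Lemma bil_mulr m (A B : 'M[R]_m) u v : bil (A *m B^T) u v = bil A u (v *m B).
Proof. by rewrite /bil trmx_mul !mulmxA. Qed.

Lemma lin_ext m (a b : 'cV[R]_m) : (forall u, lin a u = lin b u) -> a = b.
Proof.
move=> ab; apply/colP => i; have := ab (delta_mx 0 i).
by rewrite /lin -!rowE !mxE.
Qed.

Lemma bil_delta m (A : 'M[R]_m) i j : bil A (delta_mx 0 i) (delta_mx 0 j) = A i j.
Proof. by rewrite /bil -!rowE trmx_delta -!colE !mxE. Qed.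

Lemma mxtrace_bil m (A : 'M[R]_m) :
  \tr A = \sum_i bil A (delta_mx 0 i) (delta_mx 0 i).
Proof. by apply: eq_bigr => i _; rewrite bil_delta. Qed.

Lemma mxtraceN m (A : 'M[R]_m) : \tr (- A) = - \tr A.
Proof. exact: raddfN. Qed.

Lemma mxtrace_tensor m (A : 'M[R]_m) (a b : 'cV[R]_m) :
  \tr (A *m (a *m b^T)) = lin (A *m a) b^T.
Proof. by rewrite mulmxA mxtrace_mulC trace_mx11. Qed.

Lemma bil_ext m (A B : 'M[R]_m) : (forall u v, bil A u v = bil B u v) -> A = B.
Proof.
move=> AB; apply/matrixP => i j; have := AB (delta_mx 0 i) (delta_mx 0 j).
by rewrite /bil -!rowE trmx_delta -!colE !mxE.
Qed.

End Forms.

(** * Positive definite forms *)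

Section PositiveDefinite.
Context {R : rcfType}.

(** Gram-Schmidt by blocks: the congruence by [L] clears the first row and column and leaves the
    Schur complement [S]. It is again positive definite, since its values are values of [g] on the
    vectors [row_mx 0 v *m L]. The rows of [Q] form the frame. *)
Lemma orthonormal_frame n (g : 'M[R]_n) : g^T = g ->
  (forall v, v != 0 -> 0 < bil g v v) ->
  exists Q : 'M[R]_n, Q *m g *m Q^T = 1%:M.
Proof.
elim: n g => [|n IH] g gT gpos.
  by exists 0; apply/matrixP => -[].
move: g gT gpos; rewrite -[n.+1]/(1 + n)%N => g gT gpos.
pose a := ulsubmx g; pose b := ursubmx g; pose C := drsubmx g.
have gE : g = block_mx a b b^T C.
  by rewrite /a /b /C trmx_ursub gT submxK.
have aT : a^T = a by rewrite /a trmx_ulsub gT.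
have CT : C^T = C by rewrite /C trmx_drsub gT.
have a0 : 0 < a 0 0.
  have := gpos (row_mx 1%:M 0); rewrite /bil gE tr_row_mx mul_row_block.
  rewrite !mul0mx !mul1mx !addr0 mul_row_col trmx1 mulmx1 trmx0 mulmx0 addr0.
  apply; apply/eqP => /(congr1 lsubmx); rewrite row_mxKl linear0.
  by move/matrixP/(_ 0 0); rewrite !mxE => /eqP; rewrite oner_eq0.
pose k := (a 0 0)^-1.
pose L : 'M[R]_(1 + n) := block_mx 1%:M 0 (- k *: b^T) 1%:M.
pose S := C - k *: (b^T *m b).
have aE : a = (a 0 0)%:M by rewrite [LHS]mx11_scalar.
have ka : k *: a = 1%:M by rewrite aE scale_scalar_mx mulVf// gt_eqF.
have LgL : L *m g *m L^T = block_mx a 0 0 S.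
  have ba : - k *: b^T *m a + b^T = 0.
    by rewrite -scalemxAl scalemxAr scaleNr ka mulmxN mulmx1 addNr.
  rewrite gE /L mulmx_block !mul1mx !mul0mx !addr0 ba tr_block_mx.
  rewrite mulmx_block !trmx1 trmx0 !mulmx0 !mulmx1 !mul0mx !addr0 !add0r.
  congr block_mx.
  - by rewrite linearZ /= trmxK -scalemxAr scalemxAl scaleNr ka mulNmx mul1mx addNr.
  - by rewrite /S addrC -scalemxAl scaleNr.
have ST : S^T = S by rewrite /S linearB linearZ /= CT trmx_mul trmxK.
have Spos v : v != 0 -> 0 < bil S v v.
  move=> v0; have -> : bil S v v = bil g (row_mx 0 v *m L) (row_mx 0 v *m L).
    rewrite -[in RHS]bil_mulr -bil_mull mulmxA LgL /bil tr_row_mx mul_row_block.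
    by rewrite !mul0mx !mulmx0 !add0r mul_row_col trmx0 mulmx0 add0r.
  apply: gpos; apply: contra_neq v0 => /(congr1 rsubmx).
  by rewrite /L mul_row_block row_mxKr mulmx1 mul0mx add0r linear0.
have [Q0 HQ0] := IH S ST Spos.
pose Q1 : 'M[R]_(1 + n) := block_mx (Num.sqrt k)%:M 0 0 Q0.
exists (Q1 *m L).
rewrite trmx_mul -!mulmxA [L *m (g *m _)]mulmxA [L *m g *m _]mulmxA LgL.
rewrite /Q1 tr_block_mx !trmx0 tr_scalar_mx !mulmx_block.
rewrite !mul0mx !mulmx0 !addr0 !add0r [Q0 *m (_ *m _)]mulmxA HQ0.
rewrite mul_scalar_mx mul_mx_scalar scalerA -expr2 sqr_sqrtr ?invr_ge0 ?ltW//.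
by rewrite ka !mulmx0 -scalar_mx_block.
Qed.

Lemma invmx_frame n (g Q : 'M[R]_n) : g \in unitmx ->
  Q *m g *m Q^T = 1%:M -> invmx g = Q^T *m Q.
Proof.
move=> gU /mulmx1C QgQ; rewrite -[LHS]mul1mx -QgQ.
by rewrite !mulmxA mulmxK.
Qed.

Lemma bil_square_ge0 n (Q : 'M[R]_n) v : 0 <= bil (Q^T *m Q) v v.
Proof.
rewrite /bil mulmxA -mulmxA -[Q *m v^T]trmxK trmx_mul trmxK mxE.
by apply: sumr_ge0 => i _; rewrite [X in _ * X]mxE -expr2 sqr_ge0.
Qed.

Lemma bil_square_gt0 n (Q : 'M[R]_n) v : Q \in unitmx -> v != 0 ->
  0 < bil (Q^T *m Q) v v.
Proof.
move=> QU v0; rewrite lt_def bil_square_ge0 andbT.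
rewrite /bil mulmxA -mulmxA -[Q *m v^T]trmxK trmx_mul trmxK mxE.
apply: contra_neq v0 => /eqP; rewrite psumr_eq0; last first.
  by move=> i _; rewrite [X in _ * X]mxE -expr2 sqr_ge0.
move=> /allP Q0; have vQ : v *m Q^T = 0.
  apply/rowP => i; have := Q0 i (mem_index_enum i).
  by rewrite [X in _ * X]mxE -expr2 sqrf_eq0 /= => /eqP ->; rewrite mxE.
by rewrite -[v](@mulmxK _ _ _ Q^T) ?unitmx_tr// vQ mul0mx.
Qed.

(** By cyclicity the trace is that of [Q H Q^T], the sum of [H] over the rows of [Q]. *)
Lemma mxtrace_square_le0 n (Q H : 'M[R]_n) : (forall v, bil H v v <= 0) ->
  \tr (Q^T *m Q *m H) <= 0.
Proof.
move=> H0; rewrite -mulmxA mxtrace_mulC mxtrace_bil.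
by apply: sumr_le0 => i _; rewrite bil_mulr bil_mull.
Qed.

(** For [Q^T Q] the inverse metric, [K] is [G] in an orthonormal frame, and this is the squared norm
    of [G]. *)
Lemma mxtrace_square_norm n (Q G : 'M[R]_n) : G^T = G ->
  let K := Q *m G *m Q^T in
  \tr (Q^T *m Q *m G *m (Q^T *m Q *m G)) = \sum_i \sum_j K i j ^+ 2.
Proof.
move=> GT K; rewrite -!mulmxA mxtrace_mulC !mulmxA.
rewrite -[Q *m G *m Q^T]/K -[K *m Q *m G *m Q^T]/(K *m Q *m G *m Q^T).
have -> : K *m Q *m G *m Q^T = K *m K by rewrite /K !mulmxA.
have KT : K^T = K by rewrite /K !trmx_mul trmxK GT mulmxA.
apply: eq_bigr => i _; rewrite mxE; apply: eq_bigr => j _.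
by rewrite expr2; congr (_ * _); rewrite -[in LHS]KT mxE.
Qed.

Lemma mxtrace_square_norm_eq0 n (Q G : 'M[R]_n) : Q \in unitmx -> G^T = G ->
  \tr (Q^T *m Q *m G *m (Q^T *m Q *m G)) = 0 -> G = 0.
Proof.
move=> QU GT; rewrite mxtrace_square_norm// => /eqP.
rewrite psumr_eq0; last by move=> i _; apply: sumr_ge0 => j _; exact: sqr_ge0.
move=> /allP H; have K0 : Q *m G *m Q^T = 0.
  apply/matrixP => i j; have /= := H i (mem_index_enum i).
  rewrite psumr_eq0; last by move=> k _; exact: sqr_ge0.
  by move=> /allP /(_ j (mem_index_enum j)) /=; rewrite sqrf_eq0 => /eqP ->; rewrite mxE.
have : Q *m G = 0 by rewrite -[LHS](@mulmxK _ _ _ Q^T) ?unitmx_tr// K0 mul0mx.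
by move=> QG; rewrite -[G](mulKmx QU) QG mulmx0.
Qed.

End PositiveDefinite.

(** * Calculus *)

Section Calculus.
Context {R : realType}.
Implicit Types (V W : normedModType R).

(** Serves to show that differentiability is local: two functions that agree near a point differ by
    one that vanishes there. *)
Lemma near0_differentiable V W (h : V -> W) x :
  (\near x, h x = 0) -> differentiable h x.
Proof.
move=> h0.
have h00 : h x = 0 := nbhs_singleton h0.
have cz : continuous (\0 : V -> W) by move=> y; exact: cvg_cst.
have E : h \o shift x = cst (h x) + (\0 : {linear V -> W}) +o_ 0 id.
  apply/eqaddoP => _/posnumP[e].
  have h0' : \forall y \near (0 : V), h (y + x) = 0.
    have := h0; rewrite (near_shift 0) subr0 => h0'; near=> y.
    by near: y.
  near=> y.
  rewrite /= /cst !fctE /= h00 add0r subr0.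
  have -> : h (y + x) = 0 by near: y.
  by rewrite normr0 mulr_ge0.
apply/diff_locallyP; rewrite (diff_unique cz E); split => //.
Unshelve. all: by end_near. Qed.

Lemma near_eq_differentiable V W (f g : V -> W) x :
  (\near x, f x = g x) -> differentiable f x -> differentiable g x.
Proof.
move=> fg df.
have -> : g = f + (g - f) by rewrite addrC subrK.
apply: differentiableD => //; apply: near0_differentiable.
near=> y; rewrite !fctE; apply/eqP; rewrite subr_eq0; apply/eqP/esym; near: y.
exact: fg.
Unshelve. all: by end_near. Qed.

Section On.
Context {V : normedModType R} (U : set V).
Hypothesis oU : open U.

Lemma open_near_eq W (f g : V -> W) x :
  (forall y, U y -> f y = g y) -> U x -> \near x, f x = g x.
Proof.
move=> fg Ux; near=> y; apply: fg; near: y; exact: open_nbhs_nbhs.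
Unshelve. all: by end_near. Qed.

(** Openness of [U] is essential: a derivative at a point of [U] only sees values on a neighbourhood
    inside [U]. *)
Lemma C_on_ext k W (f g : V -> W) :
  (forall x, U x -> f x = g x) -> C_on k U f -> C_on k U g.
Proof.
elim: k W f g => [|k IH] W f g fg /=.
  move=> cf x Ux; have nfg := open_near_eq fg Ux.
  rewrite /prop_for /continuous_at -(fg x Ux); apply: cvg_trans (cf x Ux).
  exact: near_eq_cvg nfg.
move=> [df cf]; split => [x Ux|v].
  exact: near_eq_differentiable (open_near_eq fg Ux) (df x Ux).
apply: IH (cf v) => x Ux; apply: near_eq_derive; exact: open_near_eq.
Qed.

Lemma C_onW k W (f : V -> W) : C_on k.+1 U f -> C_on k U f.
Proof.
elim: k W f => [|k IH] W f [df cf].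
  by move=> x Ux; apply: differentiable_continuous; apply: df.
by split => // v; apply: IH.
Qed.

Lemma C_on_cst k W (w : W) : C_on k U (cst w).
Proof.
elim: k W w => [|k IH] W w /=; first by move=> x _; exact: cvg_cst.
split => [x _|v]; first exact: differentiable_cst.
by apply: (@C_on_ext _ _ (cst 0)) => // x _; rewrite derive_cst.
Qed.

Lemma C_onD k W (f g : V -> W) :
  C_on k U f -> C_on k U g -> C_on k U (fun x => f x + g x).
Proof.
elim: k W f g => [|k IH] W f g /=.
  by move=> cf cg x Ux; apply: continuousD; [apply: cf|apply: cg].
move=> [df cf] [dg cg]; split => [x Ux|v].
  by apply: differentiableD; [apply: df|apply: dg].
apply: (@C_on_ext _ _ (fun x => 'D_v f x + 'D_v g x)); last exact: IH.
by move=> x Ux; rewrite deriveD //; apply: diff_derivable; [apply: df|apply: dg].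
Qed.

Lemma C_onM k (f g : V -> R) :
  C_on k U f -> C_on k U g -> C_on k U (fun x => f x * g x).
Proof.
elim: k f g => [|k IH] f g /=.
  by move=> cf cg x Ux; apply: continuousM; [apply: cf|apply: cg].
move=> [df cf] [dg cg]; split => [x Ux|v].
  by apply: differentiableM; [apply: df|apply: dg].
apply: (@C_on_ext _ _ (fun x => f x * 'D_v g x + g x * 'D_v f x)).
  move=> x Ux; rewrite deriveM //; apply: diff_derivable; [exact: df|exact: dg].
by apply: C_onD; apply: IH => //; apply: C_onW.
Qed.

Lemma C_on_sum k W (I : Type) (r : seq I) (P : pred I) (f : I -> V -> W) :
  (forall i, P i -> C_on k U (f i)) -> C_on k U (fun x => \sum_(i <- r | P i) f i x).
Proof.
move=> cf; elim: r => [|i r IH].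
  by apply: (@C_on_ext _ _ (cst 0)); [move=> x _; rewrite big_nil|exact: C_on_cst].
have [Pi|Pi] := boolP (P i).
  apply: (@C_on_ext _ _ (fun x => f i x + \sum_(i <- r | P i) f i x)).
    by move=> x _; rewrite big_cons Pi.
  by apply: C_onD => //; apply: cf.
apply: C_on_ext IH => x _; by rewrite big_cons (negbTE Pi).
Qed.

Lemma C_on_prod k (I : Type) (r : seq I) (P : pred I) (f : I -> V -> R) :
  (forall i, P i -> C_on k U (f i)) -> C_on k U (fun x => \prod_(i <- r | P i) f i x).
Proof.
move=> cf; elim: r => [|i r IH].
  by apply: (@C_on_ext _ R (cst (1 : R))); [move=> x _; rewrite big_nil|exact: C_on_cst].
have [Pi|Pi] := boolP (P i).
  apply: (@C_on_ext _ _ (fun x => f i x * \prod_(i <- r | P i) f i x)).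
    by move=> x _; rewrite big_cons Pi.
  by apply: C_onM => //; apply: cf.
apply: C_on_ext IH => x _; by rewrite big_cons (negbTE Pi).
Qed.

Lemma C_onV k (f : V -> R) :
  (forall x, U x -> f x != 0) -> C_on k U f -> C_on k U (fun x => (f x)^-1).
Proof.
move=> f0; elim: k => [|k IH] /=.
  by move=> cf x Ux; apply: continuousV; [exact: f0|apply: cf].
move=> [df cf]; split => [x Ux|v].
  by apply: differentiableV; [apply: df|apply: f0].
apply: (@C_on_ext _ _ (fun x => - 1 * ((f x)^-1 * (f x)^-1) * 'D_v f x)).
  move=> x Ux; rewrite deriveV ?f0//; last by apply: diff_derivable; apply: df.
  by rewrite mulN1r expr2 invfM scaleNr mulNr.
have cV : C_on k U (fun x => (f x)^-1) by apply: IH; apply: C_onW.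
by apply: C_onM => //; apply: C_onM; [exact: C_on_cst|exact: C_onM].
Qed.

End On.

Lemma continuous_for_sum (T : topologicalType) W (I : Type) (r : seq I)
    (f : I -> T -> W) x :
  (forall i, {for x, continuous (f i)}) ->
  {for x, continuous (fun y => \sum_(i <- r) f i y)}.
Proof.
move=> cf; rewrite -fct_sumE; elim/big_ind: _ => //.
  exact: cvg_cst.
by move=> g h cg ch; apply: continuousD.
Qed.

Section Mx.
Context {V : normedModType R} (p q : nat).
Implicit Type A : V -> 'M[R]_(p, q).

Lemma differentiable_mxP A x :
  differentiable A x <-> forall i j, differentiable (fun x => A x i j) x.
Proof.
split => [dA i j|dA].
  exact: (differentiable_comp dA (differentiable_coord _ _ _)).
have -> : A = \sum_(i < p) \sum_(j < q) (fun x => A x i j *: delta_mx i j).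
  rewrite funeqE => y; rewrite [LHS]matrix_sum_delta fct_sumE.
  by apply: eq_bigr => i _; rewrite fct_sumE.
apply: differentiable_sum => i; apply: differentiable_sum => j.
exact: differentiableZl.
Qed.

Lemma derive_entry A x v i j : derivable A x v ->
  'D_v (fun y => A y i j) x = 'D_v A x i j.
Proof. by move=> dA; rewrite (derive_mx dA) mxE. Qed.

Lemma C_on_mxP (U : set V) k A : open U ->
  C_on k U A <-> forall i j, C_on k U (fun x => A x i j).
Proof.
move=> oU; elim: k A => [|k IH] A /=.
  split=> [cA i j x Ux|cA x Ux].
    exact: (cvg_comp _ _ (cA x Ux) (@coord_continuous _ _ _ i j (A x))).
  have -> : A = (fun y => \sum_(i < p) \sum_(j < q) A y i j *: delta_mx i j).
    by rewrite funeqE => y; rewrite [LHS]matrix_sum_delta.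
  do 2!apply: continuous_for_sum => ?.
  by apply: cvgZr_tmp; exact: cA.
split => [[dA cA] i j|cA].
  split => [x Ux|v]; first by move/differentiable_mxP: (dA x Ux).
  have /IH /(_ i j) := cA v; apply: C_on_ext => // x Ux.
  by rewrite derive_entry //; apply: diff_derivable; apply: dA.
have dA : forall x, U x -> differentiable A x.
  by move=> x Ux; apply/differentiable_mxP => i j; have [+ _] := cA i j; apply.
split => // v; apply/IH => i j; have [_ /(_ v)] := cA i j.
apply: C_on_ext => // x Ux.
by rewrite derive_entry //; apply: diff_derivable; apply: dA.
Qed.

End Mx.
End Calculus.

(** * Symmetry of second derivatives *)

Section Schwarz.
Context {R : realType} {V : normedModType R}.
Implicit Types (f : V -> R) (x u v : V).

Lemma is_derive_line f x u (s : R) : derivable f (x + s *: u) u ->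
  is_derive s 1 (fun t : R => f (x + t *: u)) ('D_u f (x + s *: u)).
Proof.
have E : (fun h : R => h^-1 *: (((fun t : R => f (x + t *: u)) \o shift s) (h *: 1)
                - f (x + s *: u))) =
  (fun h => h^-1 *: ((f \o shift (x + s *: u)) (h *: u) - f (x + s *: u))).
  rewrite funeqE => h /=; congr (_ *: (f _ - _)).
  by rewrite scalerDl [h *: 1]mulr1 addrCA.
by move=> d; split; rewrite /derivable /derive /= E.
Qed.

Lemma derivable_shift f x w u : derivable f (x + w) u ->
  derivable (fun y => f (y + w)) x u.
Proof.
rewrite /derivable => d; set F := (X in cvg (X @ _)).
suff -> : F = (fun h => h^-1 *: ((f \o shift (x + w)) (h *: u) - f (x + w))) by [].
by rewrite funeqE => h; rewrite /F /= addrA.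
Qed.

Lemma derive_translate f x w u :
  'D_u (fun y => f (y + w)) x = 'D_u f (x + w).
Proof.
rewrite /derive; set F := (X in lim (X @ _) = _).
set G := (X in _ = lim (X @ _)).
suff -> : F = G by [].
by rewrite funeqE => h; rewrite /F /G /= addrA.
Qed.

Lemma MVT_line f x u (h : R) : 0 < h ->
  (forall s, 0 <= s <= h -> derivable f (x + s *: u) u) ->
  exists2 c, 0 < c < h & f (x + h *: u) - f x = 'D_u f (x + c *: u) * h.
Proof.
move=> h0 df; pose g (t : R) := f (x + t *: u).
have dg s : 0 <= s <= h -> is_derive s 1 g ('D_u f (x + s *: u)).
  by move=> sh; apply: is_derive_line; apply: df.
have [||c ch E] := @MVT R g (fun s => 'D_u f (x + s *: u)) 0 h h0.
- by move=> s; rewrite in_itv/= => /andP[s0 sh]; apply: dg; rewrite !ltW.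
- apply: derivable_within_continuous => s; rewrite in_itv/= => sh.
  by have [] := dg s sh.
exists c; first by move: ch; rewrite in_itv.
by move: E; rewrite /g scale0r addr0 subr0.
Qed.

(** The mean value theorem twice: along [u] for the increment [f (y + h v) - f y], then along [v]
    for ['D_u f]. *)
Lemma second_difference f x u v (h : R) (U : set V) : 0 < h -> open U ->
  C_on 2 U f ->
  (forall s t, 0 <= s <= h -> 0 <= t <= h -> U (x + s *: u + t *: v)) ->
  exists s t, [/\ 0 <= s <= h, 0 <= t <= h &
    f (x + h *: u + h *: v) - f (x + h *: u) - f (x + h *: v) + f x
    = 'D_v (fun y => 'D_u f y) (x + s *: u + t *: v) * h * h].
Proof.
move=> h0 oU [df /(_ u) [ddf _]] xU.
have hh : 0 <= h <= h by rewrite lexx ltW.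
have z0 : 0 <= (0 : R) <= h by rewrite lexx ltW.
pose g y := f (y + h *: v) - f y.
have dfu y : U y -> derivable f y u by move=> Uy; apply: diff_derivable; apply: df.
have dg1 s : 0 <= s <= h -> derivable (fun y => f (y + h *: v)) (x + s *: u) u.
  by move=> sh; apply/derivable_shift/dfu/xU.
have dg2 s : 0 <= s <= h -> derivable f (x + s *: u) u.
  by move=> sh; apply: dfu; rewrite -[X in U X]addr0 -(scale0r v); exact: xU.
have dg s : 0 <= s <= h -> derivable g (x + s *: u) u.
  by move=> sh; apply: derivableB; [exact: dg1|exact: dg2].
have [s /andP[/ltW s0 /ltW sh1] E1] := @MVT_line g x u h h0 dg.
have sh : 0 <= s <= h by rewrite s0.
have dg' t : 0 <= t <= h -> derivable (fun y => 'D_u f y) (x + s *: u + t *: v) v.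
  by move=> th; apply: diff_derivable; apply: ddf; exact: xU.
have [t /andP[/ltW t0 /ltW th1] E2] :=
  @MVT_line (fun y => 'D_u f y) (x + s *: u) v h h0 dg'.
have th : 0 <= t <= h by rewrite t0.
exists s, t; split=> //; rewrite -E2.
have <- : 'D_u g (x + s *: u) = 'D_u f (x + s *: u + h *: v) - 'D_u f (x + s *: u).
  by rewrite deriveB; [rewrite derive_translate|exact: dg1|exact: dg2].
by rewrite -E1 /g; ring.
Qed.

Lemma small_parallelogram x u v (r : R) : 0 < r -> exists2 h : R, 0 < h &
  forall s t, 0 <= s <= h -> 0 <= t <= h -> ball x r (x + s *: u + t *: v).
Proof.
move=> r0; have n0 : 0 < `|u| + `|v| + 1 by rewrite ltr_wpDl// addr_ge0.
(* The half makes the final bound strict; the [+ 1] keeps the divisor positive when [u] and [v]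
   vanish. *)
pose h := r / 2 / (`|u| + `|v| + 1).
have h0 : 0 < h by rewrite !divr_gt0.
exists h => // s t /andP[s0 sh] /andP[t0 th].
rewrite -ball_normE /= -addrA opprD addNKr normrN.
apply: le_lt_trans (ler_normD _ _) _; rewrite !normrZ !ger0_norm//.
apply: (@le_lt_trans _ _ (h * (`|u| + `|v| + 1))).
  rewrite !mulrDr mulr1.
  have := ler_wpM2r (normr_ge0 u) sh; have := ler_wpM2r (normr_ge0 v) th; lra.
have -> : h * (`|u| + `|v| + 1) = r / 2 by rewrite /h divfK// gt_eqF.
by rewrite ltr_pdivrMr// ltr_pMr// ltr1n.
Qed.

Lemma dist_via (a b c d e : R) :
  `|a - c| < e / 2 -> `|b - d| < e / 2 -> c = d -> `|a - b| <= e.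
Proof.
move=> ac + cd; rewrite -cd => bc.
rewrite -(subrKA c) (splitr e) (le_trans (ler_normD _ _))//.
by rewrite (distrC c) ltW// ltrD.
Qed.

(** The second difference is symmetric in [u] and [v], so the two mixed derivatives agree at two
    possibly different points of an arbitrarily small parallelogram; their continuity at [x] does
    the rest. *)
Theorem derive_comm f (U : set V) x u v : open U -> C_on 2 U f -> U x ->
  'D_v (fun y => 'D_u f y) x = 'D_u (fun y => 'D_v f y) x.
Proof.
move=> oU cf Ux; apply/eqP; rewrite -subr_eq0 -normr_le0; apply/ler_addgt0Pl => e e0.
rewrite addr0.
have cont a b : {for x, continuous (fun y => 'D_b (fun z => 'D_a f z) y)}.
  by case: cf => _ /(_ a) [_ /(_ b)]; apply.
pose Da y := 'D_v (fun z => 'D_u f z) y; pose Db y := 'D_u (fun z => 'D_v f z) y.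
have e2 : 0 < e / 2 by rewrite divr_gt0.
have : \forall y \near x, [/\ U y, `|Da x - Da y| < e / 2 & `|Db x - Db y| < e / 2].
  have nU : \forall y \near x, U y by exact: open_nbhs_nbhs.
  have /cvgrPdist_lt /(_ _ e2) n1 := cont u v.
  have /cvgrPdist_lt /(_ _ e2) n2 := cont v u.
  apply: (@filterS3 _ (nbhs x) _ _ _ _ _ _ nU n1 n2) => y Uy d1 d2.
  split; [exact: Uy|exact: d1|exact: d2].
move=> /nbhs_ballP [r r0 Hr].
have HU y : ball x r y -> U y by case/Hr => Uy _ _; exact: Uy.
have [h h0 B] := small_parallelogram x u v r0.
have B' s t : 0 <= s <= h -> 0 <= t <= h -> ball x r (x + s *: v + t *: u).
  move=> sh th; rewrite addrAC; exact: B.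
have [|s [t [sh th E1]]] := second_difference (x := x) (u := u) (v := v) h0 oU cf.
  move=> s t sh th; exact/HU/B.
have [|s' [t' [sh' th' E2]]] := second_difference (x := x) (u := v) (v := u) h0 oU cf.
  move=> s' t' sh' th'; exact/HU/B'.
have [_ A1 _] := Hr _ (B s t sh th); have [_ _ A2] := Hr _ (B' s' t' sh' th').
have E : Da (x + s *: u + t *: v) = Db (x + s' *: v + t' *: u).
  apply: (mulIf (lt0r_neq0 h0)); apply: (mulIf (lt0r_neq0 h0)).
  rewrite -[LHS]E1 -[RHS]E2 [x + h *: v + _]addrAC; ring.
rewrite -/(Da x) -/(Db x).
exact: dist_via A1 A2 E.
Qed.

End Schwarz.

(** * Calculus of matrix-valued maps *)

Section MatrixCalculus.
Context {R : realType} {V : normedModType R}.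

Lemma derivable_mulmx p q r (A : V -> 'M[R]_(p, q)) (B : V -> 'M[R]_(q, r)) x v :
  derivable A x v -> derivable B x v -> derivable (fun y => A y *m B y) x v.
Proof.
move=> /derivable_mxP dA /derivable_mxP dB; apply/derivable_mxP => i j.
have -> : (fun y => (A y *m B y) i j) = \sum_(k < q) (fun y => A y i k * B y k j).
  by rewrite funeqE => y; rewrite mxE fct_sumE.
by apply: derivable_sum => k; apply: derivableM.
Qed.

Lemma derive_mulmx p q r (A : V -> 'M[R]_(p, q)) (B : V -> 'M[R]_(q, r)) x v :
  derivable A x v -> derivable B x v ->
  'D_v (fun y => A y *m B y) x = 'D_v A x *m B x + A x *m 'D_v B x.
Proof.
move=> dA dB; apply/matrixP => i j.
rewrite -derive_entry; last exact: derivable_mulmx.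
have -> : (fun y => (A y *m B y) i j) = \sum_(k < q) (fun y => A y i k * B y k j).
  by rewrite funeqE => y; rewrite mxE fct_sumE.
move/derivable_mxP: (dA) => dA'; move/derivable_mxP: (dB) => dB'.
rewrite derive_sum; last by move=> k; apply: derivableM.
rewrite !mxE -big_split; apply: eq_bigr => k _ /=.
rewrite deriveM// !derive_entry//= [X in _ + X]mulrC addrC; congr (_ + _).
Qed.

Lemma derivable_trmx p q (A : V -> 'M[R]_(p, q)) x v :
  derivable A x v -> derivable (fun y => (A y)^T) x v.
Proof.
move=> /derivable_mxP dA; apply/derivable_mxP => i j.
by under eq_fun do rewrite mxE; exact: dA.
Qed.

Lemma derive_trmx p q (A : V -> 'M[R]_(p, q)) x v :
  derivable A x v -> 'D_v (fun y => (A y)^T) x = ('D_v A x)^T.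
Proof.
move=> dA; apply/matrixP => i j; rewrite -derive_entry; last exact: derivable_trmx.
by under eq_fun do rewrite mxE; rewrite derive_entry// mxE.
Qed.

Section Smooth.
Variable U : set V.
Hypothesis oU : open U.

Lemma smooth_differentiable (W : normedModType R) (f : V -> W) x :
  smooth_on U f -> U x -> differentiable f x.
Proof. by move=> /(_ 1%N) [df _] Ux; apply: df. Qed.

Lemma smooth_derivable (W : normedModType R) (f : V -> W) x v :
  smooth_on U f -> U x -> derivable f x v.
Proof. by move=> sf Ux; apply: diff_derivable; apply: smooth_differentiable. Qed.

Lemma smooth_derive (W : normedModType R) (f : V -> W) v :
  smooth_on U f -> smooth_on U (fun x => 'D_v f x).
Proof. by move=> sf k; have [_] := sf k.+1; apply. Qed.

Lemma smooth_continuous (W : normedModType R) (f : V -> W) x :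
  smooth_on U f -> U x -> {for x, continuous f}.
Proof. by move=> /(_ 0%N) + Ux; apply. Qed.

Lemma smooth_ext (W : normedModType R) (f g : V -> W) :
  (forall x, U x -> f x = g x) -> smooth_on U f -> smooth_on U g.
Proof. by move=> fg sf k; apply: C_on_ext (sf k). Qed.

Lemma smooth_sub (W : normedModType R) (D : set V) (f : V -> W) :
  D `<=` U -> smooth_on U f -> smooth_on D f.
Proof.
move=> DU sf k; elim: k W f sf => [|k IH] W f sf; first by move=> x /DU; exact: (sf 0%N x).
split=> [x /DU Ux|v]; first exact: smooth_differentiable sf Ux.
exact: IH (smooth_derive v sf).
Qed.

Lemma smooth_cst (W : normedModType R) (w : W) : smooth_on U (fun=> w).
Proof. by move=> k; exact: C_on_cst. Qed.

Lemma smoothD (W : normedModType R) (f g : V -> W) :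
  smooth_on U f -> smooth_on U g -> smooth_on U (fun x => f x + g x).
Proof. by move=> sf sg k; apply: C_onD. Qed.

Lemma smoothM (f g : V -> R) :
  smooth_on U f -> smooth_on U g -> smooth_on U (fun x => f x * g x).
Proof. by move=> sf sg k; apply: C_onM. Qed.

Lemma smooth_mxP p q (A : V -> 'M[R]_(p, q)) :
  smooth_on U A <-> forall i j, smooth_on U (fun x => A x i j).
Proof.
split=> [sA i j k|sA k]; first exact: (C_on_mxP k A oU).1 (sA k) i j.
apply: (C_on_mxP k A oU).2 => i j; exact: sA.
Qed.

Lemma smoothN p q (A : V -> 'M[R]_(p, q)) :
  smooth_on U A -> smooth_on U (fun x => - A x).
Proof.
move=> /smooth_mxP sA; apply/smooth_mxP => i j; under eq_fun do rewrite mxE -mulN1r.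
by apply: smoothM => //; exact: smooth_cst.
Qed.

Lemma smoothZ p q (f : V -> R) (A : V -> 'M[R]_(p, q)) :
  smooth_on U f -> smooth_on U A -> smooth_on U (fun x => f x *: A x).
Proof.
move=> sf /smooth_mxP sA; apply/smooth_mxP => i j; under eq_fun do rewrite mxE.
exact: smoothM.
Qed.

Lemma smooth_trmx p q (A : V -> 'M[R]_(p, q)) :
  smooth_on U A -> smooth_on U (fun x => (A x)^T).
Proof.
move=> /smooth_mxP sA; apply/smooth_mxP => i j; under eq_fun do rewrite mxE.
exact: sA.
Qed.

Lemma smooth_mulmx p q r (A : V -> 'M[R]_(p, q)) (B : V -> 'M[R]_(q, r)) :
  smooth_on U A -> smooth_on U B -> smooth_on U (fun x => A x *m B x).
Proof.
move=> /smooth_mxP sA /smooth_mxP sB; apply/smooth_mxP => i j k.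
under eq_fun do rewrite mxE; apply: C_on_sum => // l _.
by apply: C_onM => //; [exact: sA|exact: sB].
Qed.

Lemma smooth_det p (A : V -> 'M[R]_p) :
  smooth_on U A -> smooth_on U (fun x => \det (A x)).
Proof.
move=> /smooth_mxP sA k; apply: C_on_sum => // s _; apply: C_onM => //.
  exact: C_on_cst.
by apply: C_on_prod => // i _; exact: sA.
Qed.

(** Cramer's formula: the entries of the adjugate are polynomials in those of [A], and the
    determinant does not vanish on [U]. *)
Lemma smooth_invmx p (A : V -> 'M[R]_p) : (forall x, U x -> A x \in unitmx) ->
  smooth_on U A -> smooth_on U (fun x => invmx (A x)).
Proof.
move=> uA sA.
apply: (@smooth_ext _ (fun x => (\det (A x))^-1 *: \adj (A x))).
  by move=> x Ux; rewrite /invmx uA.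
apply: smoothZ.
  move=> k; apply: C_onV => //; last exact: smooth_det.
  by move=> x Ux; have := uA x Ux; rewrite unitmxE unitfE.
apply/smooth_mxP => i j; under eq_fun do rewrite mxE.
apply: smoothM; first exact: smooth_cst.
apply: smooth_det; apply/smooth_mxP => a b; under eq_fun do rewrite !mxE.
by move/smooth_mxP: sA; apply.
Qed.

End Smooth.
End MatrixCalculus.

Section Directional.
Context {R : realType} {V : normedModType R} {m : nat}.
Implicit Types (x w : V).

Lemma derivable_mulmxl (u : 'rV[R]_m) n (A : V -> 'M[R]_(m, n)) x w :
  derivable A x w -> derivable (fun y => u *m A y) x w.
Proof. by move=> dA; apply: derivable_mulmx => //; exact: derivable_cst. Qed.

Lemma derive_mulmxl (u : 'rV[R]_m) n (A : V -> 'M[R]_(m, n)) x w :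
  derivable A x w -> 'D_w (fun y => u *m A y) x = u *m 'D_w A x.
Proof.
move=> dA; rewrite (@derive_mulmx _ _ _ _ _ (cst u) A) ?derive_cst//.
by rewrite mul0mx add0r.
Qed.

Lemma derive_lin (a : V -> 'cV[R]_m) u x w :
  derivable a x w -> 'D_w (fun y => (u *m a y) 0 0) x = lin ('D_w a x) u.
Proof.
move=> da; rewrite /lin derive_entry; last exact: derivable_mulmxl.
by rewrite derive_mulmxl.
Qed.

Lemma derive_bil (A : V -> 'M[R]_m) u v x w :
  derivable A x w ->
  'D_w (fun y => (u *m A y *m v^T) 0 0) x = bil ('D_w A x) u v.
Proof.
move=> dA; rewrite /bil derive_entry; last first.
  by apply: derivable_mulmx; [exact: derivable_mulmxl|exact: derivable_cst].
rewrite (@derive_mulmx _ _ _ _ _ (fun y => u *m A y) (cst v^T))//.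
- by rewrite derive_cst mulmx0 addr0 derive_mulmxl.
- exact: derivable_mulmxl.
Qed.

End Directional.

Section ScaledMatrices.
Context {R : realType} {V : normedModType R}.

Lemma derivable_scalemx p q (h : V -> R) (A : V -> 'M[R]_(p, q)) x w :
  derivable h x w -> derivable A x w -> derivable (fun y => h y *: A y) x w.
Proof.
move=> dh /derivable_mxP dA; apply/derivable_mxP => i j.
have -> : (fun y => (h y *: A y) i j) = h * (fun y => A y i j).
  by rewrite funeqE => y; rewrite mxE.
exact: derivableM dh (dA i j).
Qed.

Lemma derive_scalemx p q (h : V -> R) (A : V -> 'M[R]_(p, q)) x w :
  derivable h x w -> derivable A x w ->
  'D_w (fun y => h y *: A y) x = 'D_w h x *: A x + h x *: 'D_w A x.
Proof.
move=> dh dA; apply/matrixP => i j.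
rewrite -(derive_entry i j (derivable_scalemx dh dA)).
under eq_fun do rewrite mxE.
move/derivable_mxP: (dA) => dAij.
have := deriveM dh (dAij i j); rewrite (derive_entry i j dA) => E.
rewrite !mxE addrC [in RHS](mulrC _ (A x i j)); exact: E.
Qed.

Lemma derive_mxtrace p (A : V -> 'M[R]_p) x w :
  derivable A x w -> 'D_w (fun y => \tr (A y)) x = \tr ('D_w A x).
Proof.
move=> dA; rewrite /mxtrace.
have -> : (fun y => \sum_i A y i i) = \sum_(i < p) (fun y => A y i i).
  by rewrite funeqE => y; rewrite fct_sumE.
move/derivable_mxP: (dA) => dAij; rewrite derive_sum; last by move=> i; exact: dAij.
by apply: eq_bigr => i _; exact: derive_entry.
Qed.

End ScaledMatrices.

(** * Gradients, Hessians and Jacobians *)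

Section Gradient.
Context {R : realType} {m : nat}.
Local Notation E := 'rV[R]_m.
Variable U : set E.
Hypothesis oU : open U.

Definition grad (h : E -> R) (x : E) : 'cV[R]_m := \col_i 'D_(delta_mx 0 i) h x.
(** The Hessian in coordinates. The covariant one differs from it by first-order terms, which a
    drift can absorb. *)
Definition hess (h : E -> R) (x : E) : 'M[R]_m := 'J (fun y => (grad h y)^T) x.

Lemma derive_grad (h : E -> R) x u : differentiable h x ->
  'D_u h x = lin (grad h x) u.
Proof.
move=> dh; rewrite deriveE// [u in LHS]row_sum_delta linear_sum /lin mxE.
by apply: eq_bigr => i _; rewrite linearZ /= mxE deriveE.
Qed.

Lemma smooth_grad h : smooth_on U h -> smooth_on U (grad h).
Proof.
move=> sh; apply/(smooth_mxP oU) => i j; under eq_fun do rewrite mxE.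
exact: smooth_derive.
Qed.

Lemma derive_jacobian n (X : E -> 'rV[R]_n) x u : smooth_on U X -> U x ->
  'D_u X x = u *m 'J X x.
Proof. by move=> sX Ux; rewrite deriveEjacobian//; exact: smooth_differentiable sX Ux. Qed.

Lemma derive_grad_hess (h : E -> R) x u : smooth_on U h -> U x ->
  'D_u (grad h) x = (u *m hess h x)^T.
Proof.
move=> sh Ux; apply: trmx_inj; rewrite trmxK.
rewrite -derive_jacobian//; last exact/(smooth_trmx oU)/smooth_grad.
by rewrite (derive_trmx (smooth_derivable (smooth_grad sh) Ux)).
Qed.

Lemma smooth_jacobian n (X : E -> 'rV[R]_n) : smooth_on U X -> smooth_on U (jacobian X).
Proof.
move=> sX; apply/(smooth_mxP oU) => i j.
have : smooth_on U (fun x => ('D_(delta_mx 0 i) X x) 0 j).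
  by move/(smooth_mxP oU): (smooth_derive (delta_mx 0 i) sX); apply.
apply: (smooth_ext oU) => x Ux.
by rewrite (derive_jacobian _ sX Ux) -rowE mxE.
Qed.

(** Schwarz's theorem entry by entry: both sides are the second derivative of [X] in the directions
    [u] and [v]. *)
Lemma jacobian_comm n (X : E -> 'rV[R]_n) x u v : smooth_on U X -> U x ->
  v *m 'D_u (jacobian X) x = u *m 'D_v (jacobian X) x.
Proof.
move=> sX Ux.
have dJ w z : 'D_w (fun y => 'D_z X y) x = z *m 'D_w (jacobian X) x.
  rewrite -(derive_mulmxl z (smooth_derivable (smooth_jacobian sX) Ux)).
  apply: near_eq_derive; apply: (open_near_eq oU _ Ux) => y Uy.
  exact: derive_jacobian sX Uy.
rewrite -!dJ; apply/rowP => j.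
have dX z : smooth_on U (fun y => 'D_z X y) by exact: smooth_derive.
have e w z : ('D_w (fun y => 'D_z X y) x) 0 j
   = 'D_w (fun y => 'D_z (fun y' => X y' 0 j) y) x.
  rewrite -(derive_entry 0 j (smooth_derivable (dX z) Ux)).
  apply: near_eq_derive; apply: (open_near_eq oU _ Ux) => y Uy.
  by rewrite (derive_entry 0 j (smooth_derivable sX Uy)).
have sXj : smooth_on U (fun y => X y 0 j) by move/(smooth_mxP oU): sX => sX; exact: sX.
exact: (etrans (e u v) (etrans (derive_comm v u oU (sXj 2%N) Ux) (esym (e v u)))).
Qed.

End Gradient.

(** * The strong maximum principle *)

Section Near.
Context {R : realType} {V : normedModType R}.
Variable U : set V.
Hypothesis oU : open U.

Lemma near_segment (Q : set V) (x v : V) : (\forall y \near x, Q y) ->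
  exists2 d : R, 0 < d & forall s, 0 <= s <= d -> Q (x + s *: v).
Proof.
move=> /nbhs_ballP[r r0 rQ]; have [d d0 B] := small_parallelogram x v 0 r0.
exists d => // s sd; apply: rQ; have := B s 0 sd; rewrite scaler0 addr0.
by apply; rewrite lexx ltW.
Qed.

Lemma near_pos (h : V -> R) x : smooth_on U h -> U x -> 0 < h x ->
  \forall y \near x, U y /\ 0 < h y.
Proof.
move=> sh Ux h0; have nU : \forall y \near x, U y by exact: open_nbhs_nbhs.
have ch : h @ x --> h x := smooth_continuous sh Ux.
have nh : \forall t \near x, 0 < h t := cvgr_gt _ ch _ h0.
by near=> y; split; near: y; [exact: nU|exact: nh].
Unshelve. all: by end_near. Qed.

End Near.

(** * Derivatives at an interior maximum *)

Section InteriorMaximum.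
Context {R : realType} {m : nat}.
Local Notation E := 'rV[R]_m.
Variable U : set E.
Hypothesis oU : open U.

(** A positive derivative would persist along a short segment and make [h] grow there. The opposite
    sign comes from the direction [- v]. *)
Lemma derive_at_max_le0 (h : E -> R) x v : smooth_on U h -> U x ->
  (forall y, U y -> h y <= h x) -> 'D_v h x <= 0.
Proof.
move=> sh Ux hmax; rewrite leNgt; apply/negP => D0.
have [d d0 Q] := near_segment v (near_pos oU (smooth_derive v sh) Ux D0).
have dseg s : 0 <= s <= d -> derivable h (x + s *: v) v.
  by move=> /Q[Uy _]; exact: smooth_derivable sh Uy.
have [c /andP[/ltW c0 /ltW cd] Ec] := MVT_line d0 dseg.
have [_ Dc] : U (x + c *: v) /\ 0 < 'D_v h (x + c *: v) by apply: Q; rewrite c0.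
have [Ud _] : U (x + d *: v) /\ 0 < 'D_v h (x + d *: v).
  by apply: Q; rewrite lexx ltW.
have : 0 < h (x + d *: v) - h x by rewrite Ec mulr_gt0.
by rewrite subr_gt0 ltNge hmax.
Qed.

Lemma derive_at_max (h : E -> R) x v : smooth_on U h -> U x ->
  (forall y, U y -> h y <= h x) -> 'D_v h x = 0.
Proof.
move=> sh Ux hmax; have dh := smooth_differentiable sh Ux.
apply/eqP; rewrite eq_le; apply/andP; split; first exact: derive_at_max_le0.
have := derive_at_max_le0 (- v) sh Ux hmax.
by rewrite !derive_grad// lin_Nr oppr_le0.
Qed.

Lemma hess_derive (h : E -> R) x u v : smooth_on U h -> U x ->
  bil (hess h x) u v = 'D_u (fun y => 'D_v h y) x.
Proof.
move=> sh Ux.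
have E1 : 'D_u (fun y => 'D_v h y) x = 'D_u (fun y => (v *m grad h y) 0 0) x.
  apply: near_eq_derive; apply: (open_near_eq oU _ Ux) => y Uy.
  exact: derive_grad (smooth_differentiable sh Uy).
have E2 := derive_lin v (smooth_derivable (v := u) (smooth_grad oU sh) Ux).
rewrite (derive_grad_hess oU u sh Ux) -bil_lin in E2.
exact: (esym (etrans E1 E2)).
Qed.

(** A positive second derivative persists along a short segment. As the first derivative vanishes at
    [x], it is positive further along, so [h] grows: the mean value theorem is used once for each
    order. *)
Lemma hess_at_max (h : E -> R) x v : smooth_on U h -> U x ->
  (forall y, U y -> h y <= h x) -> bil (hess h x) v v <= 0.
Proof.
move=> sh Ux hmax; rewrite (hess_derive _ _ sh Ux) leNgt; apply/negP => D0.
have sDh := smooth_derive v sh.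
have [d d0 Q] := near_segment v (near_pos oU (smooth_derive v sDh) Ux D0).
have UQ s : 0 <= s <= d -> U (x + s *: v) by case/Q.
have dseg s : 0 <= s <= d -> derivable h (x + s *: v) v.
  by move=> /UQ Uy; exact: smooth_derivable sh Uy.
have [c /andP[c0 /ltW cd] Ec] := MVT_line d0 dseg.
have dseg' s : 0 <= s <= c -> derivable (fun y => 'D_v h y) (x + s *: v) v.
  move=> /andP[s0 sc]; apply: (smooth_derivable sDh); apply: UQ.
  by rewrite s0 (le_trans sc).
have [c' /andP[/ltW c'0 /ltW c'c] Ec'] := MVT_line c0 dseg'.
have [_ Dc] : U (x + c' *: v) /\ 0 < 'D_v (fun y => 'D_v h y) (x + c' *: v).
  by apply: Q; rewrite c'0 (le_trans c'c).
have D1 := derive_at_max v sh Ux hmax.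
have Ud : U (x + d *: v) by apply: UQ; rewrite lexx ltW.
have D1c : 0 < 'D_v h (x + c *: v).
  by move: Ec'; rewrite /= D1 subr0 => ->; exact: mulr_gt0.
have : 0 < h (x + d *: v) - h x by rewrite Ec; exact: mulr_gt0.
by rewrite subr_gt0 ltNge hmax.
Qed.

End InteriorMaximum.

(** * A second-order elliptic operator *)

Section EllipticOperator.
Context {R : realType} {m : nat}.
Local Notation E := 'rV[R]_m.
Variable U : set E.
Hypothesis oU : open U.
Variables (a : E -> 'M[R]_m) (b : E -> E).
Hypotheses (sa : smooth_on U a) (sb : smooth_on U b).
Hypothesis aframe : forall x, U x -> exists2 Q : 'M[R]_m, Q \in unitmx & a x = Q^T *m Q.

(** The factor 2 is the one in the equation for the squared norm of the Lee form. Ellipticity is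
    pointwise: [a x] is a square [Q^T Q] with [Q] invertible. *)
Definition ellop (h : E -> R) x := lin (grad h x) (b x) + 2 * \tr (a x *m hess h x).

(** The gradient vanishes and the Hessian is nonpositive, so its trace against a square is too. *)
Lemma ellop_at_max (h : E -> R) (V : set E) x : open V -> V `<=` U -> smooth_on V h -> V x ->
  (forall y, V y -> h y <= h x) -> ellop h x <= 0.
Proof.
move=> oV VU sh Vx hmax; rewrite /ellop.
rewrite -(derive_grad _ (smooth_differentiable sh Vx)).
rewrite (derive_at_max oV _ sh Vx hmax) add0r pmulr_rle0//.
have [Q _ ->] := aframe (VU _ Vx).
by apply: mxtrace_square_le0 => v; exact: (hess_at_max oV v sh Vx hmax).
Qed.

Lemma grad_comb (h1 h2 : E -> R) (c : R) x : differentiable h1 x -> differentiable h2 x ->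
  grad (fun y => h1 y + c * h2 y) x = grad h1 x + c *: grad h2 x.
Proof.
move=> d1 d2; apply/colP => i; rewrite !mxE.
have dd1 := diff_derivable (v := delta_mx 0 i) d1.
have dd2 := diff_derivable (v := delta_mx 0 i) d2.
refine (etrans (deriveD dd1 (derivableZ (k := c) dd2)) _).
by rewrite (deriveZ c dd2).
Qed.

Lemma smooth_comb (h1 h2 : E -> R) (c : R) : smooth_on U h1 -> smooth_on U h2 ->
  smooth_on U (fun y => h1 y + c * h2 y).
Proof.
by move=> s1 s2; apply: smoothD => //; apply: smoothM => //; exact: smooth_cst.
Qed.

Lemma hess_comb (h1 h2 : E -> R) (c : R) x : smooth_on U h1 -> smooth_on U h2 -> U x ->
  hess (fun y => h1 y + c * h2 y) x = hess h1 x + c *: hess h2 x.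
Proof.
move=> s1 s2 Ux; apply/row_matrixP => i; rewrite !rowE; apply: trmx_inj.
set u := delta_mx 0 i.
have dg1 := smooth_derivable (v := u) (smooth_grad oU s1) Ux.
have dg2 := smooth_derivable (v := u) (smooth_grad oU s2) Ux.
have E0 := derive_grad_hess oU u (smooth_comb c s1 s2) Ux.
have E1 : 'D_u (grad (fun y => h1 y + c * h2 y)) x =
  'D_u (fun y => grad h1 y + c *: grad h2 y) x.
  apply: near_eq_derive; apply: (open_near_eq oU _ Ux) => y Uy.
  by apply: grad_comb; [exact: smooth_differentiable s1 Uy|
    exact: smooth_differentiable s2 Uy].
have E2 := deriveD dg1 (derivableZ (k := c) dg2).
rewrite (deriveZ c dg2) (derive_grad_hess oU u s1 Ux) (derive_grad_hess oU u s2 Ux) in E2.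
refine (etrans (esym E0) (etrans E1 (etrans E2 _))).
by rewrite mulmxDr -scalemxAr trmxD [in RHS]linearZ.
Qed.

Lemma ellop_comb (h1 h2 : E -> R) (c : R) x : smooth_on U h1 -> smooth_on U h2 -> U x ->
  ellop (fun y => h1 y + c * h2 y) x = ellop h1 x + c * ellop h2 x.
Proof.
move=> s1 s2 Ux; rewrite /ellop (hess_comb c s1 s2 Ux).
rewrite (grad_comb c (smooth_differentiable s1 Ux) (smooth_differentiable s2 Ux)).
move: (grad h1 x) (grad h2 x) (hess h1 x) (hess h2 x) (b x) (a x) => g1 g2 H1 H2 b0 a0.
rewrite linD mulmxDr mxtraceD -scalemxAr mxtraceZ.
have -> : lin (c *: g2) b0 = c * lin g2 b0 by rewrite /lin -scalemxAr mxE.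
ring.
Qed.

(** Needed so that positivity of the operator on the barrier spreads from one point to a ball. *)
Lemma smooth_ellop (h : E -> R) : smooth_on U h -> smooth_on U (ellop h).
Proof.
move=> sh; apply: smoothD => //.
  have := smooth_mulmx oU sb (smooth_grad oU sh).
  by move/(smooth_mxP oU); apply.
apply: smoothM => //; first exact: smooth_cst.
have sH : smooth_on U (hess h).
  exact/(smooth_jacobian oU)/(smooth_trmx oU)/(smooth_grad oU).
have /(smooth_mxP oU) saH := smooth_mulmx oU sa sH.
by move=> k; apply: C_on_sum => // i _; exact: saH.
Qed.

End EllipticOperator.

(** * The barrier function *)

Section Barrier.
Context {R : realType} {m : nat}.
Local Notation E := 'rV[R]_m.
Variables (U : set E) (x0 mu : E) (al : R).
Hypothesis oU : open U.

Lemma smooth_id : smooth_on U (id : E -> E).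
Proof.
case=> [|k] /=; first by move=> x _; exact: cvg_id.
split=> [x _|v]; first by case: (is_diff_id x).
apply: (C_on_ext oU (f := cst v)); last exact: C_on_cst.
by move=> x _; rewrite derive_id.
Qed.

(* tfun y = |y - c|^2 - |x0 - c|^2 for c = x0 - mu / 2, so that tfun <= 0 is a
   closed ball having x0 on its boundary. *)
Definition tfun (y : E) : R := ((y + (mu - x0)) *m (y - x0)^T) 0 0.
(* Positive inside that ball near x0, negative outside; its Hessian at x0 has a
   large positive part 2 al mu^T mu, which makes it a strict subsolution. *)
Definition barrier (y : E) : R := tfun y * (al * tfun y - 1).

Lemma smooth_shift (w : E) : smooth_on U (fun y => y + w).
Proof. by apply: smoothD => //; [exact: smooth_id|exact: smooth_cst]. Qed.

Lemma smooth_tfun : smooth_on U tfun.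
Proof.
have := smooth_mulmx oU (smooth_shift (mu - x0)) (smooth_trmx oU (smooth_shift (- x0))).
by move/(smooth_mxP oU); apply.
Qed.

Lemma smooth_barrier : smooth_on U barrier.
Proof.
apply: smoothM => //; first exact: smooth_tfun.
apply: smoothD => //; last exact: smooth_cst.
by apply: smoothM => //; [exact: smooth_cst|exact: smooth_tfun].
Qed.

Lemma D_shift (w y v : E) : 'D_v (fun y => y + w) y = v.
Proof.
have di : derivable (id : E -> E) y v by exact: derivable_id.
have dc : derivable (cst w : E -> E) y v by exact: derivable_cst.
refine (etrans (deriveD di dc) _).
by rewrite derive_id derive_cst addr0.
Qed.

Lemma D_tfun y v : U y -> 'D_v tfun y = lin (2 *: (y - x0) + mu)^T v.
Proof.
move=> Uy.
have d1 := smooth_derivable (v := v) (smooth_shift (- x0)) Uy.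
have d2 := smooth_derivable (v := v) (smooth_shift (mu - x0)) Uy.
have d3 := derivable_mulmx d2 (derivable_trmx d1).
have E2 := derive_mulmx d2 (derivable_trmx d1).
rewrite (derive_trmx d1) !D_shift in E2.
have E3 := derive_entry 0 0 d3; rewrite E2 in E3.
refine (etrans E3 _); rewrite mxE /lin.
rewrite [X in X + _ = _]dotC [RHS]dotC.
have -> : 2 *: (y - x0) + mu = (y - x0) + (y + (mu - x0)).
  by rewrite scaler_nat mulr2n -!addrA; congr (_ + (_ + (_ + _))); rewrite addrC.
by rewrite [in RHS]mulmxDl [RHS]mxE.
Qed.

Lemma grad_barrier y : U y ->
  grad barrier y = (2 * al * tfun y - 1) *: (2 *: (y - x0) + mu)^T.
Proof.
move=> Uy; apply: lin_ext => v.
rewrite -derive_grad; last exact: smooth_differentiable smooth_barrier Uy.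
have dt := smooth_derivable (v := v) smooth_tfun Uy.
have d2 : derivable (al *: tfun) y v by exact: derivableZ.
have dc : derivable (cst (-1) : E -> R) y v by exact: derivable_cst.
have d3 := derivableD d2 dc.
have E := deriveM dt d3.
rewrite (deriveD d2 dc) (deriveZ al dt) in E.
rewrite derive_cst addr0 D_tfun// in E.
refine (etrans E _).
have -> : (al *: tfun + cst (-1)) y = al * tfun y - 1 by [].
rewrite linZ; move: (lin _ v) (tfun y) => l t.
rewrite /GRing.scale /=; ring.
Qed.

Lemma tfun0 : tfun x0 = 0.
Proof. by rewrite /tfun subrr trmx0 mulmx0 mxE. Qed.

Lemma barrier0 : barrier x0 = 0.
Proof. by rewrite /barrier tfun0 mul0r. Qed.

Hypothesis Ux0 : U x0.

Lemma grad_barrier0 : grad barrier x0 = - mu^T.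
Proof. by rewrite grad_barrier// tfun0 subrr scaler0 add0r mulr0 add0r scaleN1r. Qed.

Lemma hess_barrier0 : hess barrier x0 = (2 * al) *: (mu^T *m mu^T^T) - 2 *: 1%:M.
Proof.
apply: bil_ext => u v; rewrite bil_lin.
rewrite -(derive_grad_hess oU u smooth_barrier Ux0).
pose c y := 2 * al * tfun y - 1; pose w (y : E) := (2 *: (y - x0) + mu)^T.
have E1 : 'D_u (grad barrier) x0 = 'D_u (fun y => c y *: w y) x0.
  apply: near_eq_derive; apply: (open_near_eq oU _ Ux0) => y Uy.
  exact: grad_barrier.
have dt := smooth_derivable (v := u) smooth_tfun Ux0.
have d2 : derivable ((2 * al) *: tfun) x0 u by exact: derivableZ.
have dc1 : derivable (cst (-1) : E -> R) x0 u by exact: derivable_cst.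
have dc : derivable c x0 u by exact: derivableD d2 dc1.
have Ec : 'D_u c x0 = 2 * al * lin mu^T u.
  refine (etrans (deriveD d2 dc1) _); rewrite (deriveZ (2 * al) dt) derive_cst.
  by rewrite addr0 D_tfun// subrr scaler0 add0r.
have ds : derivable (fun y => y - x0) x0 u.
  exact: smooth_derivable (smooth_shift (- x0)) Ux0.
have dm : derivable (cst mu : E -> E) x0 u by exact: derivable_cst.
have dsm := derivableD (derivableZ (k := 2) ds) dm.
have dw : derivable w x0 u by exact: derivable_trmx dsm.
have Ew : 'D_u w x0 = (2 *: u)^T.
  refine (etrans (derive_trmx dsm) _); congr (_^T).
  refine (etrans (deriveD (derivableZ (k := 2) ds) dm) _).
  by rewrite (deriveZ 2 ds) D_shift derive_cst addr0.
have E2 := derive_scalemx dc dw; rewrite Ec Ew in E2.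
rewrite (etrans E1 E2) /c /w tfun0 subrr scaler0 add0r mulr0 add0r scaleN1r.
rewrite bilD bilN !bilZ bil_tensor linD linN linZ; congr (_ - _).
  by rewrite mulrA.
by rewrite bil_lin mulmx1 [in LHS]linearZ /= linZ.
Qed.

(** Only the first term depends on [al], and its coefficient is positive when [mu] is nonzero and
    [a x0] positive definite; a large [al] therefore makes the value positive. *)
Lemma ellop_barrier0 (a : E -> 'M[R]_m) (b : E -> E) :
  ellop a b barrier x0
  = 4 * al * bil (a x0) mu mu - (lin mu^T (b x0) + 4 * \tr (a x0)).
Proof.
rewrite /ellop grad_barrier0 hess_barrier0 linN.
rewrite mulmxBr -!scalemxAr mulmx1 mxtraceD mxtraceN !mxtraceZ mxtrace_tensor trmxK.
have -> : lin (a x0 *m mu^T) mu = bil (a x0) mu mu by rewrite /lin /bil mulmxA.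
ring.
Qed.

End Barrier.

(** * Contact sets and Hopf's principle *)

Section Hopf.
Context {R : realType} {m : nat}.
Local Notation E := 'rV[R]_m.
Implicit Types (x y z mu : E).

(** The norm of row vectors is the maximum norm, whose balls have corners; touching balls have to be
    Euclidean. *)
Definition sq (z : E) : R := (z *m z^T) 0 0.

Lemma sqE z : sq z = \sum_i z 0 i ^+ 2.
Proof. by rewrite /sq mxE; apply: eq_bigr => i _; rewrite mxE expr2. Qed.

Lemma sq_norm z (s : R) : 0 <= s -> sq z <= s ^+ 2 -> `|z| <= s.
Proof.
move=> s0 zs; rewrite /Num.Def.normr /= mx_normrE bigmax_le//= => -[i j] _ /=.
rewrite ord1 -ler_sqr ?nnegrE// (le_trans _ zs)// sqE (bigD1 j)//=.
by rewrite real_normK ?num_real// lerDl sumr_ge0// => k _; exact: sqr_ge0.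
Qed.

Lemma sq_gt0 z : z != 0 -> 0 < sq z.
Proof.
apply: contraNT; rewrite -leNgt => z0; rewrite -normr_le0.
by apply: sq_norm => //; rewrite expr0n.
Qed.

Lemma sqN z : sq (- z) = sq z.
Proof. by rewrite /sq raddfN /= mulmxN mulNmx opprK. Qed.

(** Used with [mu = x0 - y], where the left side is [sq (x - y)]: the ball [tfun <= 0], which has
    the segment from [y] to [x0] as a diameter, lies in the ball of centre [y] through [x0] and
    meets its boundary only at [x0]. *)
Lemma sq_tfun x0 mu x : sq (x + (mu - x0)) = 2 * tfun x0 mu x - sq (x - x0) + sq mu.
Proof.
rewrite /tfun; have -> : x + (mu - x0) = (x - x0) + mu by rewrite addrCA addrC.
move: (x - x0) => h.
pose dot (y z : E) := (y *m z^T) 0 0.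
have dl y z w : dot (y + z) w = dot y w + dot z w by rewrite /dot mulmxDl mxE.
have dr y z w : dot w (y + z) = dot w y + dot w z by rewrite /dot trmxD mulmxDr mxE.
rewrite /sq -!/(dot _ _) !dl !dr (dotC h mu : dot h mu = dot mu h); ring.
Qed.

Lemma compact_cball (x0 : E) (r : R) : compact [set x : E | `|x - x0| <= r].
Proof.
have -> : [set x : E | `|x - x0| <= r] = closed_ball_ Num.Def.normr x0 r.
  by apply/seteqP; split => x /=; rewrite /closed_ball_ /= distrC.
apply: bounded_closed_compact; last exact: closed_closed_ball_.
exists (`|x0| + r); split; first exact: num_real.
move=> M Mr x /=; rewrite /closed_ball_ /= distrC => xr.
rewrite -(subrK x0 x) (le_trans (ler_normD _ _))// addrC.
by rewrite (le_trans _ (ltW Mr))// lerD2l.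
Qed.

Lemma smooth_sq (U : set E) y : open U -> smooth_on U (fun x => sq (x - y)).
Proof.
move=> oU; have s := smooth_shift oU (- y).
have := smooth_mulmx oU s (smooth_trmx oU s).
by move/(smooth_mxP oU); apply.
Qed.

Lemma closed_sublevel (h : E -> R) (c : R) : smooth_on setT h ->
  closed [set x | h x <= c].
Proof.
move=> sh; apply: (@preimage_closed _ _ h [set t | t <= c]); last exact: closed_le.
by move=> x _; exact: smooth_continuous sh I.
Qed.

Variables (U : set E) (a : E -> 'M[R]_m) (b : E -> E) (u : E -> R).
Hypothesis oU : open U.
Hypotheses (sa : smooth_on U a) (sb : smooth_on U b) (su : smooth_on U u).
Hypothesis aframe : forall x, U x -> exists2 Q : 'M[R]_m, Q \in unitmx & a x = Q^T *m Q.
Hypothesis Lu : forall x, U x -> 0 <= ellop a b u x.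

Lemma within_U (A : set E) (h : E -> R) : A `<=` U -> smooth_on U h ->
  {within A, continuous h}.
Proof.
move=> AU sh; apply: continuous_in_subspaceT => x /set_mem Ax.
exact: smooth_continuous sh (AU _ Ax).
Qed.

Lemma barrier_neg x0 mu (al : R) x : 0 < tfun x0 mu x -> al * tfun x0 mu x < 1 ->
  barrier x0 mu al x < 0.
Proof. by move=> t0 t1; rewrite /barrier pmulr_rlt0// subr_lt0. Qed.

(** By compactness [u] stays a fixed amount below [u x0] on [K], where [w] is bounded above; a small
    multiple of [w] cannot close the gap. *)
Lemma comparison_on_sphere (w : E -> R) x0 (r : R) (K : set E) : smooth_on U w ->
  K `<=` U -> compact K -> (forall x, K x -> u x < u x0) ->
  exists2 e : R, 0 < e & forall x, K x -> u x + e * w x < u x0.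
Proof.
move=> sw KU cK Ku; have [K0|K0] := pselect (K !=set0); last first.
  by exists 1 => // x Kx; case: K0; exists x.
have [c /set_mem Kc uc] := EVT_max_rV K0 cK (within_U KU su).
have [c' /set_mem Kc' wc] := EVT_max_rV K0 cK (within_U KU sw).
have eta0 : 0 < u x0 - u c by rewrite subr_gt0 Ku.
have W0 : 0 < `|w c'| + 1 by rewrite ltr_wpDl.
(* Half the gap, divided by an upper bound of [w] made positive by the [+ 1]. *)
exists ((u x0 - u c) / 2 / (`|w c'| + 1)); first by rewrite !divr_gt0.
move=> x Kx; have uxc := uc x (mem_set Kx); have wxc := wc x (mem_set Kx).
set e := _ / _.
have e0 : 0 < e by rewrite !divr_gt0.
have eW : e * (`|w c'| + 1) = (u x0 - u c) / 2 by rewrite /e divfK// gt_eqF.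
have h1 : e * w x <= e * (`|w c'| + 1).
  by rewrite ler_pM2l// (le_trans wxc)// (le_trans (ler_norm _))// lerDl.
rewrite eW in h1; move: (e * w x) h1 => z h1; lra.
Qed.

(* Otherwise adding a small multiple of the barrier to u gives a function with
   an interior maximum near x0, where the operator is positive. *)
Lemma hopf_contact x0 mu : U x0 -> mu != 0 -> (forall x, U x -> u x <= u x0) ->
  ~ (forall x, U x -> x != x0 -> tfun x0 mu x <= 0 -> u x < u x0).
Proof.
move=> Ux0 mu0 umax uneg.
have [Q QU aE] := aframe Ux0.
pose p := bil (a x0) mu mu; have p0 : 0 < p by rewrite /p aE bil_square_gt0.
pose k := lin mu^T (b x0) + 4 * \tr (a x0).
(* Then [4 al p - k = |k| + 1 - k], which is at least 1. *)
pose al := (`|k| + 1) / (4 * p).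
have al0 : 0 < al by rewrite divr_gt0 ?ltr_wpDl// mulr_gt0.
pose w := barrier x0 mu al.
have sw : smooth_on U w by exact: smooth_barrier.
have Lw0 : 0 < ellop a b w x0.
  rewrite /w (ellop_barrier0 mu al oU Ux0) -/p -/k.
  have -> : 4 * al * p = `|k| + 1.
    by rewrite /al mulrAC mulrC divfK// mulf_neq0// ?pnatr_eq0// gt_eqF.
  by have := ler_norm k; lra.
have st : smooth_on U (fun y => 1 - al * tfun x0 mu y).
  apply: (smooth_ext oU (f := fun y => 1 + (- al) * tfun x0 mu y)).
    by move=> y _; rewrite mulNr.
  apply: (smooth_comb oU); [exact: smooth_cst|exact: smooth_tfun].
have t00 : 0 < 1 - al * tfun x0 mu x0 by rewrite tfun0 mulr0 subr0.
have n1 := near_pos oU (smooth_ellop oU sa sb sw) Ux0 Lw0.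
have n2 := near_pos oU st Ux0 t00.
(* On a small ball the barrier is a strict subsolution, and it is negative wherever [tfun] is
   positive. *)
have : \forall y \near x0, [/\ U y, 0 < ellop a b w y & 0 < 1 - al * tfun x0 mu y].
  near=> y; have [Uy h1] : U y /\ 0 < ellop a b w y by near: y; exact: n1.
  have [_ h2] : U y /\ 0 < 1 - al * tfun x0 mu y by near: y; exact: n2.
  by split; [exact: Uy|exact: h1|exact: h2].
move=> /nbhs_ballP[r r0 Hr].
pose rho := r / 2; have rho0 : 0 < rho by rewrite divr_gt0.
have rhor : rho < r by rewrite /rho ltr_pdivrMr// ltr_pMr// ltr1n.
pose D := [set x : E | `|x - x0| <= rho].
have HD x : D x -> [/\ U x, 0 < ellop a b w x & 0 < 1 - al * tfun x0 mu x].
  move=> Dx; apply: Hr; rewrite -ball_normE /= distrC; exact: le_lt_trans Dx rhor.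
have DU : D `<=` U by move=> x /HD[].
have cD : compact D by exact: compact_cball.
(* The part of the boundary of [D] where the barrier may be positive; there [u] is strictly below
   [u x0]. *)
pose K := D `&` ([set x | rho <= `|x - x0|] `&` [set x | tfun x0 mu x <= 0]).
have cK : compact K.
  apply: compact_closedI => //; apply: closedI; last first.
    by apply: closed_sublevel; exact: smooth_tfun openT.
  apply: (@preimage_closed _ _ (fun x : E => `|x - x0|) [set t | rho <= t]).
    move=> x _; apply: continuous_comp; last exact: norm_continuous.
    exact: smooth_continuous (smooth_shift openT (- x0)) I.
  exact: closed_ge.
have KU : K `<=` U by move=> x [/DU].
have Ku x : K x -> u x < u x0.
  move=> [Dx [/= xr tx]]; apply: uneg => //; first exact: DU.
  by apply/eqP => xx0; move: xr; rewrite xx0 subrr normr0 leNgt rho0.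
have [e e0 He] := comparison_on_sphere rho sw KU cK Ku.
pose v y := u y + e * w y.
have sv : smooth_on U v by exact: smooth_comb.
have D0 : D x0 by rewrite /D /= subrr normr0 ltW.
have [x1 /set_mem Dx1 vmax] := EVT_max_rV (ex_intro _ x0 D0) cD (within_U DU sv).
have vx0 : v x0 = u x0 by rewrite /v /w barrier0 mulr0 addr0.
have vx1 : u x0 <= v x1 by rewrite -vx0; exact: vmax (mem_set D0).
have [Ux1 Lw1 t1] := HD _ Dx1.
(* On the boundary either [x1] lies in [K], where the choice of [e] applies, or the barrier is
   negative; in both cases [v] would be less than [u x0], its value at the centre. *)
have x1r : `|x1 - x0| < rho.
  rewrite ltNge; apply/negP => x1r.
  have [t0|t0] := leP (tfun x0 mu x1) 0.
    by have := He x1 (conj Dx1 (conj x1r t0)); rewrite ltNge => /negP; apply.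
  have wneg : w x1 < 0 by apply: barrier_neg => //; rewrite -subr_gt0.
  have ewneg : e * w x1 < 0 by rewrite pmulr_rlt0.
  move: vx1; rewrite leNgt => /negP; apply; rewrite /v.
  by rewrite -[ltRHS]addr0; apply: ler_ltD; [exact: umax|exact: ewneg].
pose V := ball x0 rho.
have VD x : V x -> D x by rewrite /V -ball_normE /= distrC => /ltW.
have Vx1 : V x1 by rewrite /V -ball_normE /= distrC.
have VU : V `<=` U by move=> x /VD /DU.
have svV : smooth_on V v := smooth_sub VU sv.
have vV y : V y -> v y <= v x1 by move=> /VD Dy; exact: vmax (mem_set Dy).
have oV : open V by exact: ball_open.
have := ellop_at_max b aframe oV VU svV Vx1 vV.
rewrite (ellop_comb oU a b e su sw Ux1) leNgt => /negP; apply.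
by rewrite ltr_wpDl ?Lu// mulr_gt0.
Unshelve. all: by end_near. Qed.

(** If [u] were not constant near [q], a ball around a nearby point below the maximum would touch
    the contact set in the way that [hopf_contact] excludes. *)
Theorem strong_maximum q : U q -> (forall x, U x -> u x <= u q) ->
  \forall y \near q, u y = u q.
Proof.
move=> Uq umax; apply: contrapT => nq.
have [r r0 Hr] : exists2 r : R, 0 < r & ball q r `<=` U.
  by apply/nbhs_ballP; exact: open_nbhs_nbhs.
(* Points at distance at most [|q - y|] from [y] are then within [2 s = r / 2] of [q], hence in
   [U]. *)
pose s := r / 4; have s0 : 0 < s by rewrite divr_gt0.
have [y [ys Uy uy]] : exists y, [/\ sq (y - q) < s ^+ 2, U y & u y <> u q].
  apply: contrapT => ny; apply: nq.
  have sm : smooth_on U (fun y => s ^+ 2 + (-1) * sq (y - q)).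
    by apply: (smooth_comb oU); [exact: smooth_cst|exact: smooth_sq].
  have q0 : 0 < s ^+ 2 + (-1) * sq (q - q).
    by rewrite subrr /sq mul0mx mxE mulr0 addr0 exprn_gt0.
  have nn := near_pos oU sm Uq q0.
  near=> y; apply: contrapT => uy; apply: ny; exists y.
  have [Uy yq] : U y /\ 0 < s ^+ 2 + (-1) * sq (y - q) by near: y; exact: nn.
  by split; [rewrite mulN1r subr_gt0 in yq|exact: Uy|exact: uy].
have uyq : u y < u q by rewrite lt_neqAle umax// andbT; apply/eqP.
(* A point of the contact set nearest to y is touched by a ball centred at y on
   which u < u q. *)
pose K := [set x : E | sq (x - y) <= sq (q - y)].
have qy : sq (q - y) < s ^+ 2 by rewrite -sqN opprB.
have Kball x : K x -> `|x - q| <= s + s.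
  move=> Kx; rewrite -(subrKA y) (le_trans (ler_normD _ _))// lerD//.
    by apply: sq_norm; [exact: ltW|exact: le_trans Kx (ltW qy)].
  by apply: sq_norm; exact: ltW.
have KU : K `<=` U.
  move=> x /Kball xq; apply: Hr; rewrite -ball_normE /= distrC.
  by apply: le_lt_trans xq _; rewrite /s; lra.
pose Z := K `&` [set x | u x = u q].
have clK : closed K by apply: closed_sublevel; exact: smooth_sq openT.
have clZ : closed Z.
  (* [u] is continuous only on [U], so closedness is checked by hand: if [u z < u q], the inequality
     persists near [z] and leaves no contact point there. *)
  move=> z clz.
  have Kz : K z by apply: clK; apply: closure_subset clz => x [].
  split=> //=; apply: contrapT => uz.
  have uzq : u z < u q by rewrite lt_neqAle umax ?andbT; [apply/eqP|exact: KU].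
  have sm : smooth_on U (fun y => u q + (-1) * u y).
    by apply: (smooth_comb oU) => //; exact: smooth_cst.
  have z0 : 0 < u q + (-1) * u z by rewrite mulN1r subr_gt0.
  have [x [[_ /= uxq] [_]]] := clz _ (near_pos oU sm (KU _ Kz) z0).
  by rewrite uxq mulN1r subrr ltxx.
have cZ : compact Z.
  apply: (subclosed_compact clZ (@compact_cball q (s + s))).
  by move=> x [/Kball].
have Zq : Z q by split=> //=; rewrite /K /= lexx.
have [x0 /set_mem [Kx0 ux0] x0min] := EVT_min_rV (ex_intro _ q Zq) cZ
  (within_U (fun x (Zx : Z x) => KU x Zx.1) (smooth_sq y oU)).
have mu0 : x0 - y != 0.
  by rewrite subr_eq0; apply/eqP => x0y; move: uyq; rewrite -ux0 x0y ltxx.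
apply: (@hopf_contact x0 (x0 - y) (KU _ Kx0) mu0).
  by move=> x Ux; rewrite ux0; exact: umax.
move=> x Ux xx0 tx; rewrite ltNge; apply/negP => uxx.
have uxq : u x = u q by apply/le_anti; rewrite umax// -ux0 uxx.
have := sq_tfun x0 (x0 - y) x.
have -> : x + (x0 - y - x0) = x - y by rewrite [x0 - y]addrC addrK.
have hs : 0 < sq (x - x0) by rewrite sq_gt0// subr_eq0.
move=> E1.
have lt1 : sq (x - y) < sq (x0 - y) by rewrite E1; lra.
have Kx : K x by rewrite /K /= (le_trans (ltW lt1)).
by have := x0min x (mem_set (conj Kx uxq)); rewrite leNgt lt1.
Unshelve. all: by end_near. Qed.

End Hopf.

(** * The Lee form in a chart *)

Section LeeDerivative.
Context {R : realType} {m : nat}.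
Local Notation E := 'rV[R]_m.
Variables (U : set E) (g : E -> 'M[R]_m) (th : E -> 'cV[R]_m).
Variable D : (E -> E) -> (E -> E) -> E -> E.
Hypothesis oU : open U.
Hypotheses (sg : smooth_on U g) (sth : smooth_on U th).
Hypothesis gunit : forall x, U x -> g x \in unitmx.
Hypothesis gsym : forall x, U x -> (g x)^T = g x.
Hypothesis th_closed : forall X Y, smooth_on U X -> smooth_on U Y ->
    forall x, U x -> ext_deriv1 th X Y x = 0.
Hypothesis D_LC : levi_civita U g D.

Let T := sharp g th.

(* The components of L_T g. *)
Definition lie_metric x := 'D_(T x) g x + 'J T x *m g x + g x *m ('J T x)^T.

Lemma smooth_sharp : smooth_on U T.
Proof.
apply: smooth_mulmx => //; first exact: smooth_trmx.
exact: smooth_invmx.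
Qed.

Lemma vderiv_ev2 X Y x (w : E) : smooth_on U X -> smooth_on U Y -> U x ->
  'D_w (ev2 g X Y) x = bil (g x) ('D_w X x) (Y x) + bil ('D_w g x) (X x) (Y x)
    + bil (g x) (X x) ('D_w Y x).
Proof.
move=> sX sY Ux.
have dX := smooth_derivable (v := w) sX Ux.
have dY := smooth_derivable (v := w) sY Ux.
have dg := smooth_derivable (v := w) sg Ux.
have dXg := derivable_mulmx dX dg.
have d3 := derivable_mulmx dXg (derivable_trmx dY).
have E1 := derive_entry 0 0 d3.
refine (etrans E1 _).
rewrite (derive_mulmx dXg (derivable_trmx dY)) (derive_mulmx dX dg) (derive_trmx dY).
by rewrite mulmxDl /bil !mxE.
Qed.

Lemma cov_deriv_ev2 X Y x : smooth_on U X -> smooth_on U Y -> U x ->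
  cov_deriv D th X Y x = bil (g x) (D X T x) (Y x).
Proof.
move=> sX sY Ux; have [_ _ Dg] := D_LC.
have E1 : vderiv X (ev1 th Y) x = vderiv X (ev2 g T Y) x.
  apply: near_eq_derive; apply: (open_near_eq oU _ Ux) => y Uy.
  by rewrite (ev2_sharp th Y (gunit Uy)).
have E2 := Dg X T Y sX smooth_sharp sY x Ux.
have E3 := ev2_sharp th (D X Y) (gunit Ux).
rewrite /cov_deriv E1 E2 E3 addrK; exact: erefl.
Qed.

(** For a torsion-free connection the antisymmetric part of [D theta] is [d theta]. *)
Lemma cov_deriv_sym X Y x : smooth_on U X -> smooth_on U Y -> U x ->
  cov_deriv D th X Y x = cov_deriv D th Y X x.
Proof.
move=> sX sY Ux; have [_ Dt _] := D_LC.
have H := th_closed sX sY Ux; have Hb := Dt X Y sX sY x Ux.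
rewrite /ext_deriv1 in H; rewrite /cov_deriv.
have E1 : ev1 th (bracket X Y) x = ev1 th (D X Y) x - ev1 th (D Y X) x.
  by rewrite /ev1 -Hb mulmxBl !mxE.
rewrite E1 in H; move: (vderiv X _ x) (vderiv Y _ x) (ev1 _ (D X Y) x) (ev1 _ (D Y X) x) H.
move=> p q r s H; lra.
Qed.

(** Metric compatibility along [T], with [D_T X] replaced by [D_X T + [T, X]]: the derivatives of
    [X] and [Y] cancel, and [(D theta)(X, Y) + (D theta)(Y, X)] remains. *)
Lemma cov_deriv_lie X Y x : smooth_on U X -> smooth_on U Y -> U x ->
  2 * cov_deriv D th X Y x = bil (lie_metric x) (X x) (Y x).
Proof.
move=> sX sY Ux; have [_ Dt Dg] := D_LC; have sT := smooth_sharp.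
have H := Dg T X Y sT sX sY x Ux; rewrite /vderiv (vderiv_ev2 _ sX sY Ux) in H.
have HX := Dt T X sT sX x Ux; have HY := Dt T Y sT sY x Ux.
rewrite /bracket (derive_jacobian (X x) sT Ux) in HX.
rewrite /bracket (derive_jacobian (Y x) sT Ux) in HY.
have EX : D T X x = D X T x + 'D_(T x) X x - X x *m 'J T x.
  by rewrite -addrA -HX addrC subrK.
have EY : D T Y x = D Y T x + 'D_(T x) Y x - Y x *m 'J T x.
  by rewrite -addrA -HY addrC subrK.
have c1 := cov_deriv_ev2 sX sY Ux; have c2 := cov_deriv_ev2 sY sX Ux.
have cs := cov_deriv_sym sX sY Ux.
rewrite -[ev2 g (D T X) Y x]/(bil (g x) (D T X x) (Y x)) in H.
rewrite -[ev2 g X (D T Y) x]/(bil (g x) (X x) (D T Y x)) in H.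
rewrite EX EY !(bil_Dl, bil_Nl, bil_Dr, bil_Nr) -c1 in H.
rewrite (bil_sym (X x) (D Y T x) (gsym Ux)) -c2 -cs in H.
rewrite /lie_metric !bilD bil_mull bil_mulr.
move: H; move: (cov_deriv D th X Y x) (bil (g x) ('D_(T x) X x) (Y x))
  (bil ('D_(T x) g x) (X x) (Y x)) (bil (g x) (X x) ('D_(T x) Y x)).
move: (bil (g x) (X x *m _) _) (bil (g x) (X x) _) => p q c r s t; lra.
Qed.

End LeeDerivative.

(** * Matrix identities at a point *)

Section PointAlgebra.
Context {R : realFieldType} {m : nat}.
Local Notation E := 'rV[R]_m.
Implicit Types (u v w : E).

(** The last hypothesis is [theta (J (4 N (u, v))) = 0] on constant fields, with [be] standing for
    theta o J. The Leibniz rule trades derivatives of [J] for those of [be] and [th]; the latter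
    cancel because theta is closed, and what is left compares [d be] on [(J u, J v)] and
    [(u, v)]. *)
Lemma dbeta_algebra (J : 'M[R]_m) (th be : 'cV[R]_m) (DJ : E -> 'M[R]_m)
    (Dth Dbe : E -> 'cV[R]_m) u v :
  J *m J = - 1%:M -> be = J *m th ->
  (forall w, DJ w *m J = - (J *m DJ w)) ->
  (forall w, Dbe w = DJ w *m th + J *m Dth w) ->
  (forall a b, lin (Dth a) b = lin (Dth b) a) ->
  lin be (v *m DJ (u *m J) - u *m DJ (v *m J)
     + u *m DJ v *m J - v *m DJ u *m J) = 0 ->
  lin (Dbe (u *m J)) (v *m J) - lin (Dbe (v *m J)) (u *m J)
  = lin (Dbe u) v - lin (Dbe v) u.
Proof.
move=> JJ beE DJJ DbeE closed.
have E w : DJ w *m th = Dbe w - J *m Dth w by rewrite DbeE addrK.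
have h1 w z : lin be (z *m DJ w) = - lin (Dbe w) (z *m J) - lin (Dth w) z.
  rewrite -lin_mul beE mulmxA DJJ mulNmx -mulmxA E.
  by rewrite mulmxBr mulmxA JJ mulNmx mul1mx opprK linN linD lin_mul opprD.
have h2 w z : lin be (z *m DJ w *m J) = - lin (Dbe w) z + lin (Dth w) (z *m J).
  rewrite -lin_mul beE mulmxA JJ mulNmx mul1mx -lin_mul mulmxN linN E.
  by rewrite linD linN lin_mul opprD opprK.
rewrite !(lin_Dr, lin_Nr) !h1 !h2.
rewrite (closed (u *m J) v) (closed (v *m J) u).
lra.
Qed.

(** Cartan's formula for [L_T F], with [A] and [B] the Jacobians of [T] and [be]. The contraction of
    [F] with [T] is [- be]; the last hypothesis is its derivative and eliminates the derivatives of
    [F] contracted with [T]. *)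
Lemma sigma_algebra (F A B : 'M[R]_m) (th be : 'cV[R]_m) (T : E)
    (D : E -> 'M[R]_m) :
  F^T = - F -> T *m F = - be^T ->
  (forall u v w, bil (D u) v w - bil (D v) u w + bil (D w) u v =
    lin th u * bil F v w - lin th v * bil F u w + lin th w * bil F u v) ->
  (forall w, w *m A *m F + T *m D w = - (w *m B)) ->
  D T + A *m F + F *m A^T
  = lin th T *: F + th *m be^T - be *m th^T - B + B^T.
Proof.
move=> Fskew TF dF dTF; apply: bil_ext => u v.
have tF w z : bil (D w) T z = - bil B w z - bil (A *m F) w z.
  have : T *m D w = - (w *m B) - w *m A *m F by rewrite -dTF [RHS]addrC addKr.
  by rewrite /bil => ->; rewrite mulmxBl mulNmx !mxE mulmxA.
have bt z : bil F T z = - lin be z by rewrite bil_lin TF raddfN /= trmxK linN.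
have FA : F *m A^T = - (A *m F)^T by rewrite trmx_mul Fskew mulNmx opprK.
rewrite FA; have := dF T u v; rewrite !tF !bt !(bilD, bilN, bilZ, bil_tensor, bilT).
lra.
Qed.

(** [J] rotates the pair [(th, be)] to [(be, - th)] and so preserves the wedge product of the
    two. *)
Lemma sigma_inv_algebra (J F C : 'M[R]_m) (th be : 'cV[R]_m) c :
  J *m F *m J^T = F -> J *m th = be -> J *m be = - th ->
  J *m C *m J^T = C ->
  let s := c *: F + th *m be^T - be *m th^T - C in J *m s *m J^T = s.
Proof.
move=> JFJ Jth Jbe JCJ s; rewrite /s.
rewrite !(mulmxDr, mulmxDl, mulmxN, mulNmx) JCJ -scalemxAr -scalemxAl JFJ.
have -> : J *m (th *m be^T) *m J^T = - (be *m th^T).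
  by rewrite mulmxA Jth -mulmxA -trmx_mul Jbe raddfN /= mulmxN.
have -> : J *m (be *m th^T) *m J^T = - (th *m be^T).
  by rewrite mulmxA Jbe -mulmxA -trmx_mul Jth mulNmx.
by rewrite opprK; congr (_ + _); rewrite -!addrA; congr (_ + _); rewrite addrC.
Qed.

(** [L] below is [L_T J]. From [g = F J^T] one has [L_T g = s J^T + F L^T]. Since [J^2] is constant,
    [L] anticommutes with [J], so [F L^T] is J-anti-invariant, while [L_T g] and [s J^T] are
    J-invariant: it vanishes, and [F] is invertible. *)
Lemma LJ_algebra (J F A DF DJ s : 'M[R]_m) :
  J *m J = - 1%:M -> J *m F *m J^T = F -> DJ *m J = - (J *m DJ) ->
  F \in unitmx -> DF + A *m F + F *m A^T = s -> J *m s *m J^T = s ->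
  let G := DF *m J^T + F *m DJ^T + A *m (F *m J^T) + F *m J^T *m A^T in
  J *m G *m J^T = G -> DJ = J *m A - A *m J /\ G = s *m J^T.
Proof.
move=> JJ JFJ DJJ Fu sE sJ G GJ.
pose L := DJ + A *m J - J *m A.
have GE : G = s *m J^T + F *m L^T.
  apply: bil_ext => u v; rewrite /G /L -sE.
  rewrite !(bilD, bil_mulr) !(bil_mulr, bil_mull) !(mulmxDr, mulmxN, mulmxA) !(bil_Dr, bil_Nr).
  ring.
have LJ : L *m J = - (J *m L).
  rewrite /L mulmxBl mulmxDl DJJ -[A *m J *m J]mulmxA JJ mulmxN mulmx1.
  rewrite mulmxBr mulmxDr [J *m (J *m A)]mulmxA JJ mulNmx mul1mx opprK !opprD.
  by rewrite mulmxA addrAC.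
have FL : F *m L^T = 0.
  have JFL : J *m (F *m L^T) *m J^T = - (F *m L^T).
    rewrite mulmxA -mulmxA -trmx_mul.
    have -> : J *m L = - (L *m J) by rewrite LJ opprK.
    by rewrite -[in RHS]JFJ raddfN /= mulmxN trmx_mul !mulmxA.
  have : F *m L^T = - (F *m L^T).
    by apply: (addrI (s *m J^T)); rewrite -GE -[LHS]GJ GE mulmxDr mulmxDl JFL mulmxA sJ.
  move/eqP; rewrite -addr_eq0 -mulr2n -scaler_nat scaler_eq0 pnatr_eq0 /=.
  by move/eqP.
have L0 : L = 0.
  apply: trmx_inj; rewrite trmx0.
  by rewrite -[LHS](mulKmx Fu) FL mulmx0.
split; last by rewrite GE FL addr0.
by move/eqP: L0; rewrite /L subr_eq0 => /eqP <-; rewrite addrK.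
Qed.

(** The Leibniz rule for [L_T], applied to [s = L_T F]; [Ds] is the derivative of its components
    along [T], and the last hypothesis says that [L_T] commutes with [d] on [be]. *)
Lemma lie_sigma_algebra (F A B DF DB Ga : 'M[R]_m)
    (th be df ga Dth Dbe : 'cV[R]_m) (c c' : R) :
  let C := A *m B + B *m A^T in
  let s := c *: F + th *m be^T - be *m th^T - B + B^T in
  let Ds := c' *: F + c *: DF + (Dth *m be^T + th *m Dbe^T)
    - (Dbe *m th^T + be *m Dth^T) - DB + DB^T in
  DF + A *m F + F *m A^T = s -> Dth + A *m th = df -> Dbe + A *m be = ga ->
  Ga - Ga^T = C + DB - (C + DB)^T ->
  Ds + A *m s + s *m A^T
  = c' *: F + c *: s + (df *m be^T - be *m df^T) + (th *m ga^T - ga *m th^T)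
    - (Ga - Ga^T).
Proof.
move=> C s Ds sE <- <- ->.
have -> : c *: s = c *: DF + c *: (A *m F) + c *: (F *m A^T) by rewrite -sE !scalerDr.
rewrite /Ds /C /s; apply: bil_ext => u v.
rewrite !(bilD, bilN, bilZ, bil_tensor, bilT, bil_mulr, bil_mull, linD, lin_mul).
ring.
Qed.

(** That [d] commutes with [L_T]: the second derivatives [DA] of [T] contribute a symmetric term,
    which antisymmetrisation removes. *)
Lemma Gamma_algebra (A B DB Ga : 'M[R]_m) (be : 'cV[R]_m) (DA : E -> 'M[R]_m) :
  (forall u, u *m Ga = u *m A *m B + u *m DB + u *m B *m A^T + be^T *m (DA u)^T) ->
  (forall u v, v *m DA u = u *m DA v) ->
  let C := A *m B + B *m A^T in
  Ga - Ga^T = C + DB - (C + DB)^T.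
Proof.
move=> GaE DAC C; apply: bil_ext => u v.
have bG a b : bil Ga a b = bil (A *m B) a b + bil DB a b
    + bil (B *m A^T) a b + lin be (b *m DA a).
  rewrite bil_lin GaE !trmxD !linD -[a *m A *m B]mulmxA -[a *m B *m A^T]mulmxA.
  by rewrite -!bil_lin; congr (_ + _); rewrite bil_lin trmx_mul !trmxK lin_mul.
rewrite /C !(bilD, bilN, bilT) !bG (DAC u v).
ring.
Qed.

(** With [P] the inverse of [F] one has [L_T P = - P s P]. The trace of [P s] is constant along [T],
    so applying [L_T] to it moves the derivative from [s] to [P]. *)
Lemma trace_lie_algebra (P F A DP DF s Ds : 'M[R]_m) :
  P *m F = 1%:M -> F *m P = 1%:M -> DP *m F + P *m DF = 0 ->
  DF + A *m F + F *m A^T = s -> \tr (DP *m s + P *m Ds) = 0 ->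
  \tr (P *m (Ds + A *m s + s *m A^T)) = \tr (P *m s *m (P *m s)).
Proof.
move=> PF FP DPF sE; rewrite mxtraceD => trD.
have DPE : DP = - (P *m DF *m P).
  rewrite -[LHS]mulmx1 -FP mulmxA; move/eqP: DPF; rewrite addr_eq0 => /eqP ->.
  by rewrite mulNmx.
have t1 : \tr (P *m Ds) = \tr (P *m DF *m P *m s).
  by move/eqP: trD; rewrite addrC addr_eq0 DPE mulNmx mxtraceN opprK => /eqP.
rewrite !mulmxDr !mxtraceD t1.
have -> : \tr (P *m (A *m s)) = \tr (P *m (A *m F) *m P *m s).
  by rewrite -!mulmxA [F *m (P *m s)]mulmxA FP mul1mx.
have -> : \tr (P *m (s *m A^T)) = \tr (P *m (F *m A^T) *m P *m s).
  by rewrite mulmxA mxtrace_mulC !mulmxA PF mul1mx.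
by rewrite -!mxtraceD -!mulmxDl -!mulmxDr sE !mulmxA.
Qed.

(** [P s] is conjugate to [gi G] by [J^T], whose inverse is [- J^T]. *)
Lemma trace_norm_algebra (J P s G gi : 'M[R]_m) :
  J^T *m J^T = - 1%:M -> P = J^T *m gi -> G = s *m J^T ->
  \tr (P *m s *m (P *m s)) = \tr (gi *m G *m (gi *m G)).
Proof.
move=> JJ PE GE.
have sE : s = - (G *m J^T) by rewrite GE -mulmxA JJ mulmxN mulmx1 opprK.
pose X := gi *m G.
have -> : P *m s = - (J^T *m X *m J^T) by rewrite PE sE mulmxN /X !mulmxA.
rewrite mulNmx mulmxN opprK -!mulmxA [J^T *m (J^T *m _)]mulmxA JJ.
rewrite mulNmx mul1mx !mulmxN mxtraceN mxtrace_mulC -!mulmxA JJ.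
by rewrite !(mulmxN, mulmx1, mxtraceN) opprK.
Qed.

(** [Ga] is the Jacobian of df o J. Differentiating [J] gives first-order terms in [f]; the Hessian,
    contracted with [P] and [J], meets the inverse metric. *)
Lemma trace_Gamma_algebra (J P H gi Ga : 'M[R]_m) (df : 'cV[R]_m)
    (DJ : E -> 'M[R]_m) :
  P^T = - P -> gi = - (J^T *m P) ->
  (forall u, u *m Ga = (DJ u *m df + J *m (u *m H)^T)^T) ->
  \tr (P *m Ga) = - lin df (\sum_i delta_mx 0 i *m P *m DJ (delta_mx 0 i))
                  - \tr (gi *m H).
Proof.
move=> PT giE GaE.
have bGa u v : bil Ga u v = lin (DJ u *m df) v + bil (H *m J^T) u v.
  by rewrite bil_lin GaE trmxK linD bil_mulr bil_lin; congr (_ + _); rewrite lin_mul.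
have bP (X : 'M[R]_m) u v : bil (X *m P) u v = - bil X u (v *m P).
  by rewrite -[in LHS](trmxK P) PT bil_mulr mulmxN bil_Nr.
rewrite mxtrace_mulC mxtrace_bil.
rewrite (eq_bigr (fun i => - lin df (delta_mx 0 i *m P *m DJ (delta_mx 0 i))
   + bil (H *m J^T *m P) (delta_mx 0 i) (delta_mx 0 i))).
  rewrite big_split /= -mxtrace_bil sumrN -mulmxA mxtrace_mulC giE mulNmx mxtraceN opprK.
  congr (- _ + _); rewrite /lin mulmx_suml summxE; done.
by move=> i _; rewrite !bP bGa opprD lin_mul.
Qed.

(** The coefficient [m - 4]: the trace of [P F] gives [m], and each of the four tensor products
    gives [- df(T)]. The factor 2 comes from antisymmetrising [Ga] against the skew [P]. *)
Lemma trace_lie_sigma_algebra (J P F s H gi Ga : 'M[R]_m) (th be df ga : 'cV[R]_m)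
    (T c : E) (a : R) :
  P^T = - P -> P *m F = 1%:M -> \tr (P *m s) = 0 -> P *m J = - (J^T *m P) ->
  be = J *m th -> ga = J *m df -> be^T *m P = - T ->
  \tr (P *m Ga) = - lin df c - \tr (gi *m H) ->
  \tr (P *m (lin df T *: F + a *: s + (df *m be^T - be *m df^T)
     + (th *m ga^T - ga *m th^T) - (Ga - Ga^T)))
  = lin df ((m%:R - 4) *: T + 2 *: c) + 2 * \tr (gi *m H).
Proof.
move=> PT PF Ps PJ beE gaE beP trGa.
have Pbe : P *m be = T^T.
  by apply: trmx_inj; rewrite trmx_mul PT mulmxN beP opprK trmxK.
have dfT : lin T^T df^T = lin df T.
  by rewrite /lin -trmx_mul mxE.
have t1 : \tr (P *m (be *m df^T)) = lin df T by rewrite mxtrace_tensor Pbe dfT.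
have t2 : \tr (P *m (df *m be^T)) = - lin df T.
  by rewrite mxtrace_tensor lin_mul beP lin_Nr.
have t3 : \tr (P *m (th *m ga^T)) = - lin df T.
  have JP : J^T *m P = - (P *m J) by rewrite PJ opprK.
  by rewrite mxtrace_tensor gaE trmx_mul -lin_mul mulmxA JP mulNmx -mulmxA -beE Pbe linN dfT.
have t4 : \tr (P *m (ga *m th^T)) = lin df T.
  rewrite mxtrace_tensor gaE mulmxA PJ mulNmx -mulmxA linN lin_mul -trmx_mul -beE.
  by rewrite lin_mul beP lin_Nr opprK.
have t5 : \tr (P *m Ga^T) = - \tr (P *m Ga).
  by rewrite -mxtrace_tr trmx_mul trmxK PT mulmxN mxtraceN mxtrace_mulC.
rewrite !(mulmxDr, mulmxN) -!scalemxAr !(mxtraceD, mxtraceN, mxtraceZ).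
rewrite t1 t2 t3 t4 t5 PF Ps trGa mxtrace1.
rewrite lin_Dr /lin -!scalemxAl !mxE.
ring.
Qed.

End PointAlgebra.

(** * The equation for the squared norm of the Lee form in a chart *)

Section Local.
Context {R : realType} {m : nat}.
Local Notation E := 'rV[R]_m.
Variables (U : set E) (J F : E -> 'M[R]_m) (th : E -> 'cV[R]_m).
Hypothesis oU : open U.
Hypotheses (sJ : smooth_on U J) (sF : smooth_on U F) (sth : smooth_on U th).

Let g x := F x *m (J x)^T.

Hypothesis JJ : forall x, U x -> J x *m J x = - 1%:M.
Hypothesis Fskew : forall x, U x -> (F x)^T = - F x.
Hypothesis Funit : forall x, U x -> F x \in unitmx.
Hypothesis g_sym : forall x, U x -> (g x)^T = g x.
Hypothesis th_closed : forall X Y, smooth_on U X -> smooth_on U Y ->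
    forall x, U x -> ext_deriv1 th X Y x = 0.
Hypothesis dF : forall X Y Z, smooth_on U X -> smooth_on U Y ->
    smooth_on U Z -> forall x, U x ->
    ext_deriv2 F X Y Z x = wedge12 th F X Y Z x.

Let T := sharp g th.

Hypothesis N_orth : forall X Y, smooth_on U X -> smooth_on U Y ->
  forall (s t : R) x, U x ->
    ev2 g (nijenhuis J X Y) (fun y => s *: T y + t *: app J T y) x = 0.

(* theta o J; vectors are rows, so (J th) u = th (u J). *)
Definition rot_lee x := J x *m th x.
Definition fform_inv x := invmx (F x).
Definition lee_jac x := 'J T x.
Definition rot_lee_jac x := 'J (fun y => (rot_lee y)^T) x.

Lemma acs_unit x : U x -> J x \in unitmx.
Proof.
move=> Ux; have : J x *m (- J x) = 1%:M by rewrite mulmxN JJ// opprK.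
by case/mulmx1_unit.
Qed.

Lemma g_unit x : U x -> g x \in unitmx.
Proof. by move=> Ux; rewrite unitmx_mul Funit//= unitmx_tr acs_unit. Qed.

Lemma smooth_g : smooth_on U g.
Proof. by apply: smooth_mulmx => //; apply: smooth_trmx. Qed.

Lemma smooth_T : smooth_on U T.
Proof.
apply: smooth_mulmx => //; first exact: smooth_trmx.
apply: smooth_invmx => //; [exact: g_unit|exact: smooth_g].
Qed.

Lemma smooth_rot_lee : smooth_on U rot_lee.
Proof. exact: smooth_mulmx. Qed.

Lemma sharp_metric x : U x -> T x *m g x = (th x)^T.
Proof. by move=> Ux; rewrite /T /sharp mulmxKV// g_unit. Qed.

Lemma trmx_acs_sqr x : U x -> (J x)^T *m (J x)^T = - 1%:M.
Proof. by move=> Ux; rewrite -trmx_mul JJ// raddfN /= trmx1. Qed.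

Lemma sharp_fform x : U x -> T x *m F x = - (rot_lee x)^T.
Proof.
move=> Ux; have := congr1 (mulmx^~ (J x)^T) (sharp_metric Ux).
rewrite /g -!mulmxA trmx_acs_sqr// !mulmxN mulmx1 => /(canRL opprK) ->.
by rewrite /rot_lee trmx_mul.
Qed.

Lemma acs_fform x : U x -> J x *m F x = - (F x *m (J x)^T).
Proof.
move=> Ux; have := g_sym Ux; rewrite /g trmx_mul trmxK Fskew// mulmxN.
by move/(canRL opprK).
Qed.

Lemma fform_invariant x : U x -> J x *m F x *m (J x)^T = F x.
Proof. by move=> Ux; rewrite acs_fform// mulNmx -mulmxA trmx_acs_sqr// mulmxN mulmx1 opprK. Qed.

Lemma acs_rot_lee x : U x -> J x *m rot_lee x = - th x.
Proof. by move=> Ux; rewrite /rot_lee mulmxA JJ// mulNmx mul1mx. Qed.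

Lemma metric_acs_sharp x : U x -> g x *m (T x *m J x)^T = - rot_lee x.
Proof.
move=> Ux; rewrite trmx_mul /g -!mulmxA [(J x)^T *m (_ *m _)]mulmxA trmx_acs_sqr//.
rewrite mulNmx mul1mx mulmxN; congr (- _); apply: trmx_inj.
by rewrite trmx_mul trmxK Fskew// mulmxN sharp_fform// opprK.
Qed.

Lemma derive_cst_rV (u x w : E) : 'D_w (fun=> u : E) x = 0.
Proof. exact: derive_cst. Qed.

Lemma bracket_cst (u v x : E) : bracket (fun=> u : E) (fun=> v : E) x = 0.
Proof. by rewrite /bracket !derive_cst_rV subr0. Qed.

Lemma derive_sharp x u : U x -> 'D_u T x = u *m lee_jac x.
Proof. by move=> Ux; rewrite deriveEjacobian//; exact: smooth_differentiable smooth_T Ux. Qed.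

Lemma derive_rot_lee_jac x u : U x -> ('D_u rot_lee x)^T = u *m rot_lee_jac x.
Proof.
move=> Ux; rewrite -derive_trmx; last exact: smooth_derivable smooth_rot_lee Ux.
rewrite deriveEjacobian//.
exact: smooth_differentiable (smooth_trmx oU smooth_rot_lee) Ux.
Qed.

Lemma derive_rot_lee x u : U x -> 'D_u rot_lee x = 'D_u J x *m th x + J x *m 'D_u th x.
Proof. by move=> Ux; rewrite derive_mulmx//; exact: smooth_derivable Ux. Qed.

(** Closedness on constant fields; [dF_at] and [N_orth_at] evaluate the other two conditions in the
    same way. *)
Lemma th_closed_at x u v : U x -> lin ('D_u th x) v = lin ('D_v th x) u.
Proof.
move=> Ux; have dth w : derivable th x w by exact: smooth_derivable Ux.
have := th_closed (smooth_cst oU u) (smooth_cst oU v) Ux.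
rewrite /ext_deriv1 /vderiv /ev1 bracket_cst mul0mx mxE subr0.
rewrite (derive_lin v (dth u)) (derive_lin u (dth v)) => H.
apply/eqP; rewrite -subr_eq0; apply/eqP; exact: H.
Qed.

Lemma dF_at x u v w : U x ->
  bil ('D_u F x) v w - bil ('D_v F x) u w + bil ('D_w F x) u v =
  lin (th x) u * bil (F x) v w - lin (th x) v * bil (F x) u w
  + lin (th x) w * bil (F x) u v.
Proof.
move=> Ux; have dF' z : derivable F x z by exact: smooth_derivable Ux.
have := dF (smooth_cst oU u) (smooth_cst oU v) (smooth_cst oU w) Ux.
rewrite /ext_deriv2 /vderiv /ev2 !bracket_cst !mul0mx !mxE subr0 addr0 subr0.
by rewrite (derive_bil v w (dF' u)) (derive_bil u w (dF' v))
  (derive_bil u v (dF' w)) => H; exact: H.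
Qed.

Lemma N_orth_at x u v : U x ->
  lin (rot_lee x) (v *m 'D_(u *m J x) J x - u *m 'D_(v *m J x) J x
     + u *m 'D_v J x *m J x - v *m 'D_u J x *m J x) = 0.
Proof.
move=> Ux; have dJ z : derivable J x z by exact: smooth_derivable Ux.
(* The coefficients 0 and 1 select [J T], whose metric dual is [- rot_lee]. *)
have := N_orth (smooth_cst oU u) (smooth_cst oU v) 0 1 Ux.
rewrite /ev2 scale0r add0r scale1r /app -mulmxA metric_acs_sharp// mulmxN mxE.
move/eqP; rewrite oppr_eq0 /nijenhuis /app /bracket !derive_cst_rV !derive_mulmxl//.
move: ('D_(u *m J x) J x) ('D_(v *m J x) J x) ('D_u J x) ('D_v J x) => a b c d.
rewrite !subr0 !sub0r mulNmx opprK -scalemxAl mxE mulf_eq0 invr_eq0.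
by rewrite pnatr_eq0 /= => /eqP.
Qed.

Lemma derive_acs_anti x w : U x -> 'D_w J x *m J x = - (J x *m 'D_w J x).
Proof.
move=> Ux; have dJ z : derivable J x z by exact: smooth_derivable Ux.
have : 'D_w (fun y => J y *m J y) x = 0.
  rewrite -(derive_cst (- 1%:M : 'M[R]_m) x w); apply: near_eq_derive.
  exact: (open_near_eq oU JJ Ux).
by rewrite derive_mulmx// => /eqP; rewrite addr_eq0 => /eqP.
Qed.

Lemma ext_rot_lee_invariant x : U x ->
  J x *m (rot_lee_jac x - (rot_lee_jac x)^T) *m (J x)^T
  = rot_lee_jac x - (rot_lee_jac x)^T.
Proof.
move=> Ux; apply: bil_ext => u v.
rewrite bil_mulr bil_mull !bilD !bilN !bilT.
have bB a b : bil (rot_lee_jac x) a b = lin ('D_a rot_lee x) b.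
  by rewrite bil_lin -(derive_rot_lee_jac a Ux) trmxK.
rewrite !bB.
exact: (dbeta_algebra (JJ Ux) erefl (fun w => derive_acs_anti w Ux)
  (fun w => derive_rot_lee w Ux) (fun a b => th_closed_at a b Ux) (N_orth_at u v Ux)).
Qed.

Definition lee_sqnorm x := lin (th x) (T x).

(* L_T F, with Cartan's formula and dF = theta /\ F. *)
Definition lie_fform x := lee_sqnorm x *: F x + th x *m (rot_lee x)^T
  - rot_lee x *m (th x)^T - rot_lee_jac x + (rot_lee_jac x)^T.

Lemma derive_sharp_fform x w : U x ->
  w *m lee_jac x *m F x + T x *m 'D_w F x = - (w *m rot_lee_jac x).
Proof.
move=> Ux; have dT := smooth_derivable (v := w) smooth_T Ux.
have db := smooth_derivable (v := w) smooth_rot_lee Ux.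
have dF' := smooth_derivable (v := w) sF Ux.
have E : 'D_w (fun y => T y *m F y) x = 'D_w (fun y => - (rot_lee y)^T) x.
  by apply: near_eq_derive; exact: (open_near_eq oU sharp_fform Ux).
rewrite (derive_mulmx dT dF') (deriveN (derivable_trmx db)) (derive_trmx db) in E.
rewrite (derive_rot_lee_jac w Ux) (derive_sharp w Ux) in E; exact: E.
Qed.

Lemma lie_fformE x : U x ->
  'D_(T x) F x + lee_jac x *m F x + F x *m (lee_jac x)^T = lie_fform x.
Proof.
move=> Ux.
exact: (sigma_algebra (D := fun w => 'D_w F x) (Fskew Ux) (sharp_fform Ux)
  (fun u v w => dF_at u v w Ux) (fun w => derive_sharp_fform w Ux)).
Qed.

Lemma lie_fform_invariant x : U x -> J x *m lie_fform x *m (J x)^T = lie_fform x.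
Proof.
move=> Ux.
have := sigma_inv_algebra (lee_sqnorm x) (fform_invariant Ux) erefl
  (acs_rot_lee Ux) (ext_rot_lee_invariant Ux).
by rewrite /= /lie_fform opprB addrA addrAC.
Qed.

Let G := lie_metric g th.

(** By [L_T g = 2 D theta], this and the next hypothesis express the J-invariance of [D theta] and
    the Gauduchon condition. *)
Hypothesis lie_metric_invariant : forall x, U x -> J x *m G x *m (J x)^T = G x.
Hypothesis lie_metric_trace : forall x, U x -> \tr (invmx (g x) *m G x) = 0.

(** The first part is [L_T J = 0]: the Lee field is an infinitesimal automorphism of [J]. *)
Lemma lie_acs_metric x : U x ->
  'D_(T x) J x = J x *m lee_jac x - lee_jac x *m J x /\ G x = lie_fform x *m (J x)^T.
Proof.
move=> Ux.
have GE : G x = 'D_(T x) F x *m (J x)^T + F x *m ('D_(T x) J x)^T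
   + lee_jac x *m g x + g x *m (lee_jac x)^T.
  have dJ := smooth_derivable (v := T x) sJ Ux.
  have E := derive_mulmx (smooth_derivable (v := T x) sF Ux) (derivable_trmx dJ).
  rewrite (derive_trmx dJ) in E; rewrite -E; exact: erefl.
have GI := lie_metric_invariant Ux; rewrite GE in GI; rewrite GE.
exact: (LJ_algebra (JJ Ux) (fform_invariant Ux) (derive_acs_anti _ Ux) (Funit Ux)
  (lie_fformE Ux) (lie_fform_invariant Ux) GI).
Qed.

Lemma smooth_lee_sqnorm : smooth_on U lee_sqnorm.
Proof.
rewrite /lee_sqnorm /lin; have := smooth_mulmx oU smooth_T sth.
by move/(smooth_mxP oU); apply.
Qed.

(* df o J for f the squared norm of the Lee form. *)
Definition rot_grad x := J x *m grad lee_sqnorm x.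
Definition rot_grad_jac x := 'J (fun y => (rot_grad y)^T) x.

Lemma smooth_rot_grad : smooth_on U rot_grad.
Proof. exact/(smooth_mulmx oU sJ)/(smooth_grad oU)/smooth_lee_sqnorm. Qed.

(** Cartan's formula for the closed form theta. *)
Lemma lie_lee x : U x -> 'D_(T x) th x + lee_jac x *m th x = grad lee_sqnorm x.
Proof.
move=> Ux; apply: lin_ext => u.
rewrite linD lin_mul -derive_grad; last exact: smooth_differentiable smooth_lee_sqnorm Ux.
rewrite (th_closed_at _ _ Ux) -(derive_sharp u Ux).
have dT := smooth_derivable (v := u) smooth_T Ux.
have dth := smooth_derivable (v := u) sth Ux.
have E := derive_entry 0 0 (derivable_mulmx dT dth).
rewrite (derive_mulmx dT dth) mxE addrC in E; exact: (esym E).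
Qed.

(** Since [L_T J = 0], composition with [J] commutes with [L_T]. *)
Lemma lie_rot_lee x : U x -> 'D_(T x) rot_lee x + lee_jac x *m rot_lee x = rot_grad x.
Proof.
move=> Ux; have [LJ _] := lie_acs_metric Ux.
rewrite (derive_rot_lee _ Ux) LJ /rot_grad -(lie_lee Ux) /rot_lee.
move: ('D_(T x) th x) => a.
by rewrite mulmxDr mulmxBl !mulmxA addrAC subrK addrC.
Qed.

Lemma smooth_rot_lee_jac : smooth_on U rot_lee_jac.
Proof. exact/(smooth_jacobian oU)/(smooth_trmx oU)/smooth_rot_lee. Qed.

Lemma smooth_lee_jac : smooth_on U lee_jac.
Proof. exact/(smooth_jacobian oU)/smooth_T. Qed.

(** Obtained by differentiating the previous identity along [u]; Schwarz's theorem for [rot_lee]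
    then exchanges the directions [u] and [T]. *)
Lemma rot_grad_jacE x u : U x -> u *m rot_grad_jac x =
  u *m lee_jac x *m rot_lee_jac x + u *m 'D_(T x) rot_lee_jac x + u *m rot_lee_jac x *m (lee_jac x)^T
  + (rot_lee x)^T *m ('D_u lee_jac x)^T.
Proof.
move=> Ux.
have dT := smooth_derivable (v := u) smooth_T Ux.
have dB := smooth_derivable (v := u) smooth_rot_lee_jac Ux.
have dA := smooth_derivable (v := u) smooth_lee_jac Ux.
have dbe := smooth_derivable (v := u) smooth_rot_lee Ux.
have E0 := derive_jacobian u (smooth_trmx oU smooth_rot_grad) Ux.
have E : 'D_u (fun y => (rot_grad y)^T) x =
         'D_u (fun y => T y *m rot_lee_jac y + (rot_lee y)^T *m (lee_jac y)^T) x.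
  apply: near_eq_derive; apply: (open_near_eq oU _ Ux) => y Uy.
  have := congr1 trmx (lie_rot_lee Uy).
  rewrite trmxD trmx_mul (derive_rot_lee_jac _ Uy) => H; exact: (esym H).
refine (etrans (esym E0) (etrans E _)).
have d1 := derivable_mulmx dT dB.
have d2 := derivable_mulmx (derivable_trmx dbe) (derivable_trmx dA).
refine (etrans (deriveD d1 d2) _).
have E1 := derive_mulmx dT dB.
have E2 := derive_mulmx (derivable_trmx dbe) (derivable_trmx dA).
rewrite (derive_trmx dbe) (derive_trmx dA) (derive_rot_lee_jac _ Ux) in E2.
rewrite (derive_sharp _ Ux)
  (jacobian_comm oU _ _ (smooth_trmx oU smooth_rot_lee) Ux) in E1.
rewrite E1 E2 addrA; exact: erefl.
Qed.

Lemma ext_rot_grad x : U x ->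
  let C := lee_jac x *m rot_lee_jac x + rot_lee_jac x *m (lee_jac x)^T in
  rot_grad_jac x - (rot_grad_jac x)^T
  = C + 'D_(T x) rot_lee_jac x - (C + 'D_(T x) rot_lee_jac x)^T.
Proof.
move=> Ux C.
exact: (Gamma_algebra (DA := fun u => 'D_u lee_jac x) (fun u => rot_grad_jacE u Ux)
  (fun u v => jacobian_comm oU u v smooth_T Ux)).
Qed.

Lemma fform_invK x : U x -> fform_inv x *m F x = 1%:M.
Proof. by move=> Ux; rewrite mulVmx// Funit. Qed.

Lemma fform_invKr x : U x -> F x *m fform_inv x = 1%:M.
Proof. by move=> Ux; rewrite mulmxV// Funit. Qed.

Lemma smooth_fform_inv : smooth_on U fform_inv.
Proof. exact: smooth_invmx. Qed.

Lemma fform_inv_skew x : U x -> (fform_inv x)^T = - fform_inv x.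
Proof.
move=> Ux; rewrite -[LHS]mulmx1 -(fform_invKr Ux) mulmxA -[F x]opprK -Fskew// mulmxN.
by rewrite -trmx_mul fform_invKr// trmx1 mulNmx mul1mx.
Qed.

Lemma invmx_metric x : U x -> invmx (g x) = - ((J x)^T *m fform_inv x).
Proof.
move=> Ux; have E : g x *m - ((J x)^T *m fform_inv x) = 1%:M.
  rewrite mulmxN /g -mulmxA [(J x)^T *m (_ *m _)]mulmxA trmx_acs_sqr//.
  by rewrite mulNmx mul1mx mulmxN opprK fform_invKr.
by rewrite -[RHS](mulKmx (g_unit Ux)) E mulmx1.
Qed.

Lemma fform_inv_acs x : U x -> fform_inv x *m J x = - ((J x)^T *m fform_inv x).
Proof.
move=> Ux; rewrite -[LHS]mulmx1 -(fform_invKr Ux) -!mulmxA [J x *m _]mulmxA acs_fform//.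
by rewrite mulNmx mulmxN !mulmxA fform_invK// mul1mx.
Qed.

Lemma rot_lee_fform_inv x : U x -> (rot_lee x)^T *m fform_inv x = - T x.
Proof.
by move=> Ux; rewrite -[(rot_lee x)^T]opprK -sharp_fform// mulNmx -mulmxA fform_invKr// mulmx1.
Qed.

Lemma fform_invE x : U x -> fform_inv x = (J x)^T *m invmx (g x).
Proof. by move=> Ux; rewrite invmx_metric// mulmxN mulmxA trmx_acs_sqr// mulNmx mul1mx opprK. Qed.

(** As [F^-1 = J^T g^-1] and [L_T g = (L_T F) J^T], this is the trace of [L_T g] against the inverse
    metric. *)
Lemma trace_lie_fform x : U x -> \tr (fform_inv x *m lie_fform x) = 0.
Proof.
move=> Ux; have [_ GE] := lie_acs_metric Ux.
have := lie_metric_trace Ux; rewrite GE fform_invE//.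
move: (invmx (g x)) (lie_fform x) => gi s.
rewrite mulmxA mxtrace_mulC mulmxA => tr0.
by [].
Qed.

Lemma derive_lie_fform x w : U x -> 'D_w lie_fform x =
  'D_w lee_sqnorm x *: F x + lee_sqnorm x *: 'D_w F x
  + ('D_w th x *m (rot_lee x)^T + th x *m ('D_w rot_lee x)^T)
  - ('D_w rot_lee x *m (th x)^T + rot_lee x *m ('D_w th x)^T)
  - 'D_w rot_lee_jac x + ('D_w rot_lee_jac x)^T.
Proof.
move=> Ux.
have df := smooth_derivable (v := w) smooth_lee_sqnorm Ux.
have dF' := smooth_derivable (v := w) sF Ux.
have dth := smooth_derivable (v := w) sth Ux.
have dbe := smooth_derivable (v := w) smooth_rot_lee Ux.
have dB := smooth_derivable (v := w) smooth_rot_lee_jac Ux.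
have d1 := derivable_scalemx df dF'.
have d2 := derivable_mulmx dth (derivable_trmx dbe).
have d3 := derivable_mulmx dbe (derivable_trmx dth).
have d12 := derivableD d1 d2.
have d123 := derivableB d12 d3.
have d1234 := derivableB d123 dB.
have E1 := derive_scalemx df dF'.
have E2 := derive_mulmx dth (derivable_trmx dbe).
have E3 := derive_mulmx dbe (derivable_trmx dth).
rewrite (derive_trmx dbe) in E2; rewrite (derive_trmx dth) in E3.
refine (etrans (deriveD d1234 (derivable_trmx dB)) _).
rewrite (derive_trmx dB); congr (_ + _).
refine (etrans (deriveB d123 dB) _); congr (_ - _).
refine (etrans (deriveB d12 d3) _); rewrite E3; congr (_ - _).
refine (etrans (deriveD d1 d2) _); rewrite E1 E2; exact: erefl.
Qed.

Lemma smooth_lie_fform : smooth_on U lie_fform.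
Proof.
apply: (smoothD oU); last exact/(smooth_trmx oU)/smooth_rot_lee_jac.
apply: (smoothD oU); last exact/(smoothN oU)/smooth_rot_lee_jac.
apply: (smoothD oU); last first.
  exact/(smoothN oU)/(smooth_mulmx oU smooth_rot_lee)/(smooth_trmx oU).
apply: (smoothD oU); first exact: (smoothZ oU smooth_lee_sqnorm sF).
exact/(smooth_mulmx oU sth)/(smooth_trmx oU)/smooth_rot_lee.
Qed.

(** The first-order remainder of d(df o J). It depends on the coordinates; what matters is that it
    is smooth. *)
Definition acs_divergence x : E :=
  \sum_i delta_mx 0 i *m fform_inv x *m 'D_(delta_mx 0 i) J x.

Definition drift x : E := (m%:R - 4) *: T x + 2 *: acs_divergence x.

Lemma derive_fform_inv x w : U x -> 'D_w fform_inv x *m F x + fform_inv x *m 'D_w F x = 0.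
Proof.
move=> Ux.
rewrite -(derive_mulmx (smooth_derivable smooth_fform_inv Ux) (smooth_derivable sF Ux)).
have E : \near x, fform_inv x *m F x = 1%:M by exact: (open_near_eq oU fform_invK Ux).
rewrite (near_eq_derive _ E); exact: derive_cst.
Qed.

Lemma derive_trace_lie_fform x w : U x ->
  \tr ('D_w fform_inv x *m lie_fform x + fform_inv x *m 'D_w lie_fform x) = 0.
Proof.
move=> Ux.
have dP := smooth_derivable (v := w) smooth_fform_inv Ux.
have ds := smooth_derivable (v := w) smooth_lie_fform Ux.
rewrite -(derive_mulmx dP ds) -(derive_mxtrace (derivable_mulmx dP ds)).
have E : \near x, \tr (fform_inv x *m lie_fform x) = 0.
  by exact: (open_near_eq oU trace_lie_fform Ux).
rewrite (near_eq_derive _ E); exact: derive_cst.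
Qed.

(* Both sides equal the trace of L_T (L_T F) against F^-1. *)
Theorem bochner x : U x ->
  lin (grad lee_sqnorm x) (drift x) + 2 * \tr (invmx (g x) *m hess lee_sqnorm x)
  = \tr (invmx (g x) *m G x *m (invmx (g x) *m G x)).
Proof.
move=> Ux; have [_ GE] := lie_acs_metric Ux.
rewrite -(trace_norm_algebra (trmx_acs_sqr Ux) (fform_invE Ux) GE).
rewrite -(trace_lie_algebra (fform_invK Ux) (fform_invKr Ux) (derive_fform_inv (T x) Ux)
  (lie_fformE Ux)
  (derive_trace_lie_fform (T x) Ux)).
rewrite (derive_lie_fform _ Ux).
have := lie_sigma_algebra ('D_(T x) lee_sqnorm x) (lie_fformE Ux)
  (lie_lee Ux) (lie_rot_lee Ux) (ext_rot_grad Ux).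
cbv zeta => E.
have -> := congr1 (fun M => \tr (fform_inv x *m M)) E.
rewrite (derive_grad (T x) (smooth_differentiable smooth_lee_sqnorm Ux)).
have GamE u : u *m rot_grad_jac x =
    ('D_u J x *m grad lee_sqnorm x + J x *m (u *m hess lee_sqnorm x)^T)^T.
  have E1 := derive_jacobian u (smooth_trmx oU smooth_rot_grad) Ux.
  have dg := smooth_derivable (v := u) (smooth_grad oU smooth_lee_sqnorm) Ux.
  have E2 := derive_trmx (smooth_derivable (v := u) smooth_rot_grad Ux).
  have E3 := derive_mulmx (smooth_derivable (v := u) sJ Ux) dg.
  rewrite (derive_grad_hess oU u smooth_lee_sqnorm Ux) in E3.
  exact: (etrans (esym E1) (etrans E2 (congr1 trmx E3))).
have trG := trace_Gamma_algebra (DJ := fun u => 'D_u J x)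
  (fform_inv_skew Ux) (invmx_metric Ux) GamE.
exact: (esym (trace_lie_sigma_algebra (lee_sqnorm x)
  (fform_inv_skew Ux) (fform_invK Ux) (trace_lie_fform Ux)
  (fform_inv_acs Ux) erefl erefl (rot_lee_fform_inv Ux) trG)).
Qed.

Lemma smooth_drift : smooth_on U drift.
Proof.
apply: (smoothD oU); apply: (smoothZ oU); try exact: smooth_cst; first exact: smooth_T.
move=> k; apply: C_on_sum => // i _.
apply: (smooth_mulmx oU) k; last exact: smooth_derive.
by apply: (smooth_mulmx oU); [exact: smooth_cst|exact: smooth_fform_inv].
Qed.

Lemma lie_metric_sym x : U x -> (G x)^T = G x.
Proof.
move=> Ux; have E : ('D_(T x) g x)^T = 'D_(T x) g x.
  rewrite -(derive_trmx (smooth_derivable smooth_g Ux)).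
  apply: near_eq_derive; exact: (open_near_eq oU g_sym Ux).
rewrite /G /lie_metric; move: ('D_(T x) g x) E (g_sym Ux) => Dg DgT.
move: (g x) ('J (sharp g th) x) => h a hT.
by rewrite !trmxD DgT !trmx_mul trmxK hT addrAC.
Qed.

Hypothesis g_posdef : forall x (v : E), U x -> v != 0 -> 0 < (v *m g x *m v^T) 0 0.

Lemma metric_frame x : U x -> exists2 Q : 'M[R]_m, Q \in unitmx & invmx (g x) = Q^T *m Q.
Proof.
move=> Ux; have [Q HQ] := orthonormal_frame (g_sym Ux) (fun v => g_posdef Ux).
exists Q; last exact: invmx_frame (g_unit Ux) HQ.
by move: HQ; rewrite -mulmxA => /mulmx1_unit[].
Qed.

Lemma ellop_lee_sqnorm_ge0 x : U x ->
  0 <= ellop (fun y => invmx (g y)) drift lee_sqnorm x.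
Proof.
move=> Ux; rewrite /ellop (bochner Ux); have [Q _ ->] := metric_frame Ux.
rewrite (mxtrace_square_norm _ (lie_metric_sym Ux)).
by apply: sumr_ge0 => i _; apply: sumr_ge0 => j _; exact: sqr_ge0.
Qed.

(** Stated for an open part [V] of the chart, because a maximum over a component of the manifold is
    compared only on a coordinate ball. *)
Lemma lee_sqnorm_strong_maximum (V : set E) q : open V -> V `<=` U -> V q ->
  (forall x, V x -> lee_sqnorm x <= lee_sqnorm q) ->
  \forall y \near q, lee_sqnorm y = lee_sqnorm q.
Proof.
move=> oV VU Vq fmax.
apply: (strong_maximum (a := fun y => invmx (g y)) oV _ (smooth_sub VU smooth_drift)
  (smooth_sub VU smooth_lee_sqnorm) _ _ Vq fmax).
- exact: smooth_sub VU (smooth_invmx oU g_unit smooth_g).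
- by move=> x /VU; exact: metric_frame.
- by move=> x /VU; exact: ellop_lee_sqnorm_ge0.
Qed.

(** A constant function kills the left side of [bochner], whose right side is the squared norm of
    [G]. *)
Lemma lie_metric_eq0 x c : U x -> (\forall y \near x, lee_sqnorm y = c) -> G x = 0.
Proof.
move=> Ux fc; have [Q QU gE] := metric_frame Ux.
(* Vanishing is needed on a neighbourhood, so that the derivative can be differentiated again. *)
have Dc v : \forall y \near x, 'D_v lee_sqnorm y = 0.
  move: fc; rewrite -nbhs_nearE => /nbhs_interior; rewrite nbhs_nearE.
  apply: filterS => y fc'; have := near_eq_derive v (fc' : \forall z \near y, lee_sqnorm z = cst c z).
  by move=> ->; exact: derive_cst.
have gr0 : grad lee_sqnorm x = 0.
  by apply/colP => i; rewrite !mxE; exact: nbhs_singleton (Dc _).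
have h0 : hess lee_sqnorm x = 0.
  apply: bil_ext => u v; rewrite (hess_derive oU u v smooth_lee_sqnorm Ux).
  rewrite (near_eq_derive u (Dc v : \forall y \near x, 'D_v lee_sqnorm y = cst 0 y)).
  by rewrite derive_cst /bil mulmx0 mul0mx mxE.
have := bochner Ux; rewrite gr0 h0 mulmx0 mxtrace0 mulr0 addr0 gE /lin mulmx0 mxE.
by move/esym; exact: mxtrace_square_norm_eq0 (lie_metric_sym Ux).
Qed.

End Local.

(** * The manifold *)

Section Connected.
Context {R : realType} {V : normedModType R}.

(** A ball is a union of segments issuing from its centre. *)
Lemma connected_ball (x : V) (r : R) : 0 < r -> connected (ball x r).
Proof.
move=> r0.
pose seg y := [set x + t *: (y - x) | t in `[0, 1]%classic].
have segx y : seg y x.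
  by exists 0; [rewrite /= in_itv /= lexx ler01|rewrite scale0r addr0].
have -> : ball x r = \bigcup_(y in ball x r) seg y.
  apply/seteqP; split => [y xy|z [y xy [t]]].
    exists y => //; exists 1; first by rewrite /= in_itv /= lexx ler01.
    by rewrite scale1r addrC subrK.
  rewrite /= in_itv /= => /andP[t0 t1] <-; move: xy; rewrite -!ball_normE /=.
  rewrite opprD addNKr normrN normrZ ger0_norm// distrC; apply: le_lt_trans.
  by rewrite ler_piMl.
apply: bigcup_connected; first by exists x => y _.
move=> y _; apply: connected_continuous_connected; first exact: segment_connected.
apply: continuous_subspaceT => t.
have cc : {for t, continuous (fun _ : R => x)} by exact: cvg_cst.
have ct : {for t, continuous (fun t : R => t *: (y - x))} by exact: scalel_continuous.
exact: (continuousD cc ct).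
Qed.

End Connected.

(** * The squared norm of the Lee form on the whole manifold *)

Section Global.
Context {R : realType} {m : nat} {M : manifold R m}.
Local Notation E := 'rV[R]_m.
Variable S : lcak M.

Definition chart_sqnorm (a : chart M) : E -> R :=
  lee_sqnorm (acs S a) (fform S a) (Defs.lee S a).

Lemma metric_unit a x : cod a x -> metric S a x \in unitmx.
Proof. exact: (g_unit (@acs_sqr _ _ _ S a) (@fform_nondegenerate _ _ _ S a)). Qed.

Lemma lee_vector_metric a x : cod a x ->
  lee_vector S a x *m metric S a x = (Defs.lee S a x)^T.
Proof. by move=> ax; rewrite /lee_vector /sharp mulmxKV// metric_unit. Qed.

Lemma metric_trans a b x : overlap a b x -> metric S a x =
  'J (trans a b) x *m metric S b (trans a b x) *m ('J (trans a b) x)^T.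
Proof.
move=> abx; have [_ HJ] := acs_field S; have [_ HF] := fform_field S.
rewrite /metric (HF _ _ _ abx) -!mulmxA; congr (_ *m (_ *m _)).
by rewrite -!trmx_mul (HJ _ _ _ abx).
Qed.

Lemma overlap_cod (a b : chart M) x : overlap a b x -> cod b (trans a b x).
Proof. by move=> [ax bx]; exact: coord_cod. Qed.

(** Theta transforms as a covector and [g] as a bilinear form, so the Lee field transforms as a
    vector. *)
Lemma chart_sqnorm_trans a b x : overlap a b x ->
  chart_sqnorm a x = chart_sqnorm b (trans a b x).
Proof.
move=> abx; have [ax bx] := abx; have bx' := overlap_cod abx.
have [_ Hth] := lee_field S.
set j := 'J (trans a b) x; set y := trans a b x.
have gE : metric S a x = j *m metric S b y *m j^T := metric_trans abx.
(* The Jacobian of the change of charts is invertible because it is a factor of the invertible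
   metric. *)
have jU : j \in unitmx.
  by have := metric_unit ax; rewrite gE -mulmxA unitmx_mul => /andP[].
have TE : lee_vector S a x *m j = lee_vector S b y.
  have E1 : lee_vector S a x *m metric S a x
          = lee_vector S b y *m metric S b y *m j^T.
    by rewrite !lee_vector_metric// (Hth _ _ _ abx) trmx_mul.
  have jTU : j^T \in unitmx by rewrite unitmx_tr.
  have bU := metric_unit bx'.
  move: E1; rewrite gE; move: (metric S b y) bU => gb bU; rewrite !mulmxA => E1.
  exact: (can_inj (mulmxK bU) (can_inj (mulmxK jTU) E1)).
rewrite -[LHS]/(lin (Defs.lee S a x) (lee_vector S a x)).
rewrite -[RHS]/(lin (Defs.lee S b y) (lee_vector S b y)).
by rewrite (Hth _ _ _ abx) lin_mul TE.
Qed.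

Definition chart_at (p : M) : chart M := projT1 (cid (chart_cover p)).

Lemma chart_atP (p : M) : dom (chart_at p) p.
Proof. exact: (projT2 (cid (chart_cover p))). Qed.

Definition sqnorm (p : M) : R := chart_sqnorm (chart_at p) (Defs.coord (chart_at p) p).

Lemma sqnormE (a : chart M) (p : M) : dom a p -> sqnorm p = chart_sqnorm a (Defs.coord a p).
Proof.
move=> ap; have dp := chart_atP p.
rewrite /sqnorm (@chart_sqnorm_trans _ a).
  by rewrite /trans /= Defs.coordK.
by split; [exact: coord_cod|rewrite /= Defs.coordK].
Qed.

Lemma smooth_chart_sqnorm a : smooth_on (cod a) (chart_sqnorm a).
Proof.
exact: (smooth_lee_sqnorm (@open_cod _ _ M a) (proj1 (acs_field S) a) (proj1 (fform_field S) a)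
  (proj1 (lee_field S) a) (@acs_sqr _ _ _ S a) (@fform_nondegenerate _ _ _ S a)).
Qed.

Lemma continuous_sqnorm : continuous sqnorm.
Proof.
move=> p; pose a := chart_at p; have ap := chart_atP p : dom a p.
have E : \forall q \near p, chart_sqnorm a (Defs.coord a q) = sqnorm q.
  have na : \forall q \near p, dom a q by apply: open_nbhs_nbhs; split; [exact: open_dom|].
  by near=> q; rewrite (@sqnormE a)//; near: q.
have cf : {for p, continuous (chart_sqnorm a \o Defs.coord a)}.
  apply: continuous_comp; first exact: continuous_coord.
  exact: smooth_continuous (smooth_chart_sqnorm a) (coord_cod ap).
rewrite /prop_for /continuous_at (@sqnormE a p ap).
apply: cvg_trans cf; exact: near_eq_cvg E.
Unshelve. all: by end_near. Qed.

Section StrongMaximum.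
Hypothesis M_compact : compact [set: M].
(** The strong maximum principle in charts; what follows is topology. *)
Hypothesis local_max : forall a (V : set E) q, open V -> V `<=` cod a -> V q ->
  (forall x, V x -> chart_sqnorm a x <= chart_sqnorm a q) ->
  \forall y \near q, chart_sqnorm a y = chart_sqnorm a q.

(** The component of [p0] is closed, hence compact, and the function attains a maximum on it. The
    set [B] of maximum points in the component is closed by continuity and open by the local
    principle, so it is the whole component. *)
Lemma sqnorm_locally_constant (p0 : M) : exists c, \forall p \near p0, sqnorm p = c.
Proof.
pose C : set M := connected_component setT p0.
have Cp0 : C p0 by exact: connected_component_refl.
have cC : compact C.
  apply: (subclosed_compact _ M_compact) => //; apply: component_closed; exact: closedT.
have [q /set_mem Cq qmax] := compact_EVT_max (ex_intro _ p0 Cp0) cC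
  (continuous_subspaceT continuous_sqnorm).
pose B := C `&` [set p | sqnorm p = sqnorm q].
(* This gives neighbourhoods in the manifold, not only in the component: both the component and the
   value are controlled on a coordinate ball. *)
have Bnbhs p : B p -> nbhs p B.
  move=> [Cp pq]; pose a := chart_at p; have ap := chart_atP p : dom a p.
  have cx := coord_cod ap; set x := Defs.coord a p in cx.
  have [r r0 Hr] : exists2 r : R, 0 < r & ball x r `<=` cod a.
    by apply/nbhs_ballP; apply: open_nbhs_nbhs; split; [exact: open_cod|].
  (* The image of a coordinate ball is connected and contains [p]. *)
  have WC : param a @` ball x r `<=` C.
    move=> z Wz; apply: connected_component_trans Cp _.
    apply: (@connected_component_max _ _ (param a @` ball x r)) z Wz => //.
      by exists x; [exact: ballxx|rewrite Defs.coordK].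
    apply: connected_continuous_connected; first exact: connected_ball.
    by apply: continuous_in_subspaceT => y /set_mem /Hr; exact: continuous_param.
  have sqE y : ball x r y -> sqnorm (param a y) = chart_sqnorm a y.
    by move=> /Hr ay; rewrite (@sqnormE a) ?paramK//; exact: param_dom.
  have xE : chart_sqnorm a x = sqnorm q by rewrite -pq (@sqnormE a).
  have near_x : \forall y \near x, ball x r y /\ chart_sqnorm a y = chart_sqnorm a x.
    have n1 : \forall y \near x, ball x r y by exact: near_ball.
    have n2 : \forall y \near x, chart_sqnorm a y = chart_sqnorm a x.
      apply: (local_max (V := ball x r)) => //; [exact: ball_open|exact: ballxx|].
      move=> y xy; rewrite xE -sqE//; apply: qmax; apply/mem_set; apply: WC.
      by exists y.
    by near=> y; split; near: y.
  have na : \forall p' \near p, dom a p'.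
    by apply: open_nbhs_nbhs; split; [exact: open_dom|].
  have nc := continuous_coord ap near_x.
  near=> p'.
  have ap' : dom a p' by near: p'.
  have [bp' ep'] : ball x r (Defs.coord a p') /\
      chart_sqnorm a (Defs.coord a p') = chart_sqnorm a x.
    by near: p'; exact: nc.
  split; last by rewrite /= (@sqnormE a)// ep'.
  by apply: WC; exists (Defs.coord a p') => //; rewrite Defs.coordK.
have BC : B = C.
  apply: (@component_connected _ setT p0) => //; first by exists q.
    exists (B°); first exact: open_interior.
    apply/seteqP; split => [p Bp|p [_ /interior_subset]//].
    by split; [exact: Bp.1|exact: Bnbhs].
  exists (sqnorm @^-1` [set sqnorm q]) => //.
  by apply: preimage_closed; [move=> p _; exact: continuous_sqnorm|exact: closed_eq].
exists (sqnorm q); have : B p0 by rewrite BC.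
by move=> /Bnbhs; apply: filterS => p [].
Unshelve. all: by end_near. Qed.

Lemma chart_sqnorm_locally_constant a x : cod a x ->
  exists c, \forall y \near x, chart_sqnorm a y = c.
Proof.
move=> ax; have [c Hc] := sqnorm_locally_constant (param a x).
exists c; have n1 := continuous_param ax Hc.
have n2 : \forall y \near x, cod a y.
  by apply: open_nbhs_nbhs; split; [exact: open_cod|].
near=> y.
have ay : cod a y by near: y.
have : sqnorm (param a y) = c by near: y; exact: n1.
by rewrite (@sqnormE a) ?paramK//; exact: param_dom.
Unshelve. all: by end_near. Qed.

End StrongMaximum.
End Global.

Theorem theorem25 (R : realType) (n : nat) (M : manifold R n.*2)
    (M_compact : compact [set: M]) (S : lcak M)
    (D : chart M -> ('rV[R]_(n.*2) -> 'rV[R]_(n.*2)) ->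
         ('rV[R]_(n.*2) -> 'rV[R]_(n.*2)) -> 'rV[R]_(n.*2) -> 'rV[R]_(n.*2))
    (D_LC : levi_civita_connection S D)
    (N_orth : nijenhuis_orthogonal S) :
  anti_pluricanonical S D /\ gauduchon S D <-> lee_parallel S D.
Proof.
have sJ a : smooth_on (cod a) (acs S a) := proj1 (acs_field S) a.
have sF a : smooth_on (cod a) (fform S a) := proj1 (fform_field S) a.
have sth a : smooth_on (cod a) (Defs.lee S a) := proj1 (lee_field S) a.
have oU a := @open_cod _ _ M a.
have sg a : smooth_on (cod a) (metric S a).
  exact: (smooth_mulmx (oU a) (sF a) (smooth_trmx (oU a) (sJ a))).
pose G a := lie_metric (metric S a) (Defs.lee S a).
have covE a := cov_deriv_lie (oU a) (sg a) (sth a) (@metric_unit _ _ _ S a)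
  (@Defs.metric_sym _ _ _ S a) (@lee_closed _ _ _ S a) (D_LC a).
(* The converse comes at once: with [D theta = 0] both sides of the invariance and all terms of the
   codifferential vanish. *)
split=> [[[_ Jinv] gau]|par]; last first.
  have sc a (v : 'rV[R]_(n.*2)) : smooth_on (cod a) (fun=> v) := smooth_cst (oU a) v.
  split; first split=> //.
    move=> a X Y sX sY x ax.
    have sXJ := smooth_mulmx (oU a) sX (sJ a).
    have sYJ := smooth_mulmx (oU a) sY (sJ a).
    exact: (etrans (par a _ _ sXJ sYJ x ax) (esym (par a _ _ sX sY x ax))).
  move=> a x ax; rewrite /codiff big1 ?oppr0// => i _; rewrite big1// => j _.
  by rewrite (par a _ _ (sc a _) (sc a _) x ax) mulr0.
have cov_cst a (u v : 'rV[R]_(n.*2)) x : cod a x ->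
    2 * cov_deriv (D a) (Defs.lee S a) (fun=> u) (fun=> v) x = bil (G a x) u v.
  by move=> ax; exact: (covE a _ _ x (smooth_cst (oU a) u) (smooth_cst (oU a) v) ax).
have G_inv a x : cod a x -> acs S a x *m G a x *m (acs S a x)^T = G a x.
  move=> ax; apply: bil_ext => u v; rewrite bil_mulr bil_mull.
  have su := smooth_cst (oU a) u; have sv := smooth_cst (oU a) v.
  have H := Jinv a _ _ su sv x ax.
  have H2 := covE a _ _ x (smooth_mulmx (oU a) su (sJ a)) (smooth_mulmx (oU a) sv (sJ a)) ax.
  rewrite -(cov_cst a u v x ax) -H; exact: (esym H2).
have GT a x : cod a x -> (G a x)^T = G a x.
  move=> ax; apply: bil_ext => u v; rewrite bilT -!(cov_cst a _ _ x ax).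
  congr (2 * _); apply: (cov_deriv_sym (@lee_closed _ _ _ S a) (D_LC a)) => //;
  exact: smooth_cst.
(* The codifferential of theta is minus half the trace of [L_T g] against the inverse metric. *)
have G_trace a x : cod a x -> \tr (invmx (metric S a x) *m G a x) = 0.
  move=> ax; have := gau a x ax; rewrite /codiff => /eqP; rewrite oppr_eq0 => /eqP H.
  rewrite -[RHS](mulr0 2) -H mulr_sumr /mxtrace; apply: eq_bigr => i _.
  rewrite mxE mulr_sumr; apply: eq_bigr => j _.
  rewrite mulrCA (cov_cst a _ _ x ax) bil_delta.
  by congr (_ * _); rewrite -[in LHS](GT a x ax) [LHS]mxE.
have G0 a x : cod a x -> G a x = 0.
  move=> ax.
  have [c Hc] := chart_sqnorm_locally_constant M_compact (fun a V q =>
    @lee_sqnorm_strong_maximum _ _ _ _ _ _ (oU a) (sJ a) (sF a) (sth a) (@acs_sqr _ _ _ S a)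
     (@fform_skew _ _ _ S a) (@fform_nondegenerate _ _ _ S a) (@Defs.metric_sym _ _ _ S a)
     (@lee_closed _ _ _ S a) (@fform_lee _ _ _ S a) (N_orth a) (G_inv a) (G_trace a)
     (@Defs.metric_posdef _ _ _ S a) V q) ax.
  exact: (lie_metric_eq0 (oU a) (sJ a) (sF a) (sth a) (@acs_sqr _ _ _ S a)
     (@fform_skew _ _ _ S a) (@fform_nondegenerate _ _ _ S a) (@Defs.metric_sym _ _ _ S a)
     (@lee_closed _ _ _ S a) (@fform_lee _ _ _ S a) (N_orth a) (G_inv a) (G_trace a)
     (@Defs.metric_posdef _ _ _ S a) ax Hc).
move=> a X Y sX sY x ax.
have := covE a X Y x sX sY ax; rewrite -/(G a) G0// /bil mulmx0 mul0mx mxE => /eqP.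
by rewrite mulf_eq0 pnatr_eq0 /= => /eqP.
Qed.
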